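(* The following decision problem is PSPACE-hard: given a finite alphabet $\Sigma$, a nondeterministic finite automaton $T$ over $\Sigma$ and a rational number $\nu$, decide whether $\overrightarrow{\mathrm{AH}}_{\mathrm{ned}}(\Sigma^*,L(T))\le\nu$, where $L(T)$ is the language recognized by $T$.
   Context: An edit path from $x$ to $y$ is a sequence $p=(a_1,b_1)\cdots(a_n,b_n)$ with $(a_i,b_i)\in(\Sigma\cup\{\varepsilon\})^2\setminus\{(\varepsilon,\varepsilon)\}$, $a_1\cdots a_n=x$, $b_1\cdots b_n=y$; $|p|=n$ and $\mathrm{wgt}(p)=|\{i:a_i\ne b_i\}|$. The normalized edit distance is $\mathrm{ned}(x,y)=\min_p\mathrm{wgt}(p)/|p|$ over edit paths $p$ from $x$ to $y$ ($\mathrm{ned}(\varepsilon,\varepsilon)=0$). For languages $X,Y$, $\overrightarrow{\mathrm{AH}}_{\mathrm{ned}}(X,Y)=\lim_{k\to\infty}\sup_{x\in X,|x|\ge k}\inf_{y\in Y}\mathrm{ned}(x,y)$. *)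

(* Defs.v *)
From HB Require Import structures.
From mathcomp Require Import all_boot all_order all_algebra.
From mathcomp Require Import all_classical all_reals.
From mathcomp Require Import ereal topology sequences Rstruct Rstruct_topology.
From Stdlib Require NArith.
Set Implicit Arguments.
Unset Strict Implicit.
Unset Printing Implicit Defensive.
Import Order.TTheory GRing.Theory Num.Theory.
Local Open Scope classical_set_scope.
Local Open Scope ring_scope.

Definition R := Rdefinitions.R.

(* The alphabet Sigma is {0, ..., k-1}; words are seq nat.             *)

Definition word := seq nat.

Definition sigma_star (k : nat) : set word := [set w | all (fun a => a < k)%N w].

(* an edit operation (a,b) in (Sigma u {eps})^2 \ {(eps,eps)}; None = eps *)
Definition edit_op := (option nat * option nat)%type.
Definition edit_path := seq edit_op.

Definition is_edit_path (x y : word) (p : edit_path) : Prop :=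
  all (fun ab : edit_op => (ab.1 != None) || (ab.2 != None)) p /\
  pmap id (map fst p) = x /\ pmap id (map snd p) = y.

Definition wgt (p : edit_path) : nat := count (fun ab : edit_op => ab.1 != ab.2) p.

Definition ned (x y : word) : \bar R :=
  if (x == [::]) && (y == [::]) then 0%E
  else ereal_inf [set ((wgt p)%:R / (size p)%:R : R)%:E | p in is_edit_path x y].

Record nfa := NFA {
  nfa_nstates : nat;
  nfa_trans : seq (nat * nat * nat);   (* (p, a, q) : p --a--> q *)
  nfa_init : seq nat;
  nfa_final : seq nat }.

Definition nfa_wf (k : nat) (T : nfa) : bool :=
  all (fun t : nat * nat * nat =>
         [&& (t.1.1 < nfa_nstates T)%N, (t.1.2 < k)%N & (t.2 < nfa_nstates T)%N])
      (nfa_trans T)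
  && all (fun q => (q < nfa_nstates T)%N) (nfa_init T)
  && all (fun q => (q < nfa_nstates T)%N) (nfa_final T).

Fixpoint nfa_run (T : nfa) (p : nat) (w : word) (q : nat) : Prop :=
  match w with
  | [::] => p = q
  | a :: w' => exists r, (p, a, r) \in nfa_trans T /\ nfa_run T r w' q
  end.

Definition nfa_lang (k : nat) (T : nfa) : set word :=
  [set w | sigma_star k w /\
     exists p q, p \in nfa_init T /\ q \in nfa_final T /\ nfa_run T p w q].

Definition AH_ned (X Y : set word) : \bar R :=
  limn (fun m : nat =>
    ereal_sup [set ereal_inf [set ned x y | y in Y] | x in
                 [set x | X x /\ (m <= size x)%N]]).

Record instance := Instance {
  inst_k : nat;       (* |Sigma|, Sigma = {0,...,k-1} *)
  inst_T : nfa;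
  inst_nu : rat }.

Definition inst_valid (I : instance) : bool := nfa_wf (inst_k I) (inst_T I).

Definition AH_problem (I : instance) : Prop :=
  (AH_ned (sigma_star (inst_k I)) (nfa_lang (inst_k I) (inst_T I))
     <= (ratr (inst_nu I) : R)%:E)%E.

(* self-delimiting binary encodings *)
Fixpoint enc_pos (p : BinNums.positive) : seq bool :=
  match p with
  | BinNums.xH => [:: true; true]
  | BinNums.xO p' => enc_pos p' ++ [:: true; false]
  | BinNums.xI p' => enc_pos p' ++ [:: true; true]
  end.

Definition enc_nat (n : nat) : seq bool :=
  match BinNat.N.of_nat n with
  | BinNums.N0 => [:: false]
  | BinNums.Npos p => enc_pos p ++ [:: false]
  end.

Definition enc_list (T : Type) (e : T -> seq bool) (s : seq T) : seq bool :=
  flatten (map (fun t => true :: e t) s) ++ [:: false].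

Definition enc_int (z : int) : seq bool :=
  match z with
  | Posz n => false :: enc_nat n
  | Negz n => true :: enc_nat n
  end.

Definition enc_rat (r : rat) : seq bool := enc_int (numq r) ++ enc_int (denq r).

Definition enc_triple (t : nat * nat * nat) : seq bool :=
  enc_nat t.1.1 ++ enc_nat t.1.2 ++ enc_nat t.2.

Definition enc_nfa (T : nfa) : seq bool :=
  enc_nat (nfa_nstates T) ++ enc_list enc_triple (nfa_trans T)
  ++ enc_list enc_nat (nfa_init T) ++ enc_list enc_nat (nfa_final T).

Definition enc_instance (I : instance) : seq bool :=
  enc_nat (inst_k I) ++ enc_nfa (inst_T I) ++ enc_rat (inst_nu I).

Definition AH_language (w : seq bool) : Prop :=
  exists I : instance, enc_instance I = w /\ inst_valid I /\ AH_problem I.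

(* tape symbols: 0 = blank, 1 = bit false, 2 = bit true, others < syms  *)

Record TM := MkTM {
  tm_states : nat;
  tm_syms : nat;
  tm_start : nat;
  tm_accept : nat;
  (* delta q a = None : halt ; Some (q', b, right?) *)
  tm_delta : nat -> nat -> option (nat * nat * bool) }.

Definition tm_wf (M : TM) : Prop :=
  (3 <= tm_syms M)%N /\ (tm_start M < tm_states M)%N /\
  (tm_accept M < tm_states M)%N /\
  forall q a, (q < tm_states M)%N -> (a < tm_syms M)%N ->
    match tm_delta M q a with
    | None => True
    | Some (q', b, _) => (q' < tm_states M)%N /\ (b < tm_syms M)%N
    end.

(* configuration: state, left tape (reversed), scanned symbol, right tape *)
Record config := Config {
  cf_state : nat; cf_left : seq nat; cf_head : nat; cf_right : seq nat }.

Definition tm_step (M : TM) (c : config) : option config :=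
  match tm_delta M (cf_state c) (cf_head c) with
  | None => None
  | Some (q', b, true) =>
      match cf_right c with
      | [::] => Some (Config q' (b :: cf_left c) 0 [::])
      | r :: rs => Some (Config q' (b :: cf_left c) r rs)
      end
  | Some (q', b, false) =>
      match cf_left c with
      | [::] => Some (Config q' [::] b (cf_right c))   (* stay at left end *)
      | l :: ls => Some (Config q' ls l (b :: cf_right c))
      end
  end.

Definition sym_of_bit (b : bool) : nat := if b then 2 else 1.

Definition tm_init (M : TM) (x : seq bool) : config :=
  match map sym_of_bit x with
  | [::] => Config (tm_start M) [::] 0 [::]
  | a :: s => Config (tm_start M) [::] a s
  end.

(* configuration after n steps (None if the machine halted earlier) *)
Definition tm_cfg (M : TM) (x : seq bool) (n : nat) : option config :=
  iter n (fun oc => obind (tm_step M) oc) (Some (tm_init M x)).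

Definition cf_space (c : config) : nat := (size (cf_left c) + 1 + size (cf_right c))%N.

Fixpoint bits_prefix (s : seq nat) : seq bool :=
  match s with
  | 1%N :: s' => false :: bits_prefix s'
  | 2%N :: s' => true :: bits_prefix s'
  | _ => [::]
  end.

Definition cf_output (c : config) : seq bool := bits_prefix (cf_head c :: cf_right c).

Definition poly_bound (a d n : nat) : nat := (a * n ^ d + a)%N.

Definition in_PSPACE (L : seq bool -> Prop) : Prop :=
  exists (M : TM) (a d : nat), tm_wf M /\
    forall x : seq bool,
      (exists n c, tm_cfg M x n = Some c /\ tm_step M c = None /\
                   (cf_state c = tm_accept M <-> L x)) /\
      (forall n c, tm_cfg M x n = Some c -> (cf_space c <= poly_bound a d (size x))%N).

Definition poly_time_computable (f : seq bool -> seq bool) : Prop :=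
  exists (M : TM) (a d : nat), tm_wf M /\
    forall x : seq bool, exists n c, (n <= poly_bound a d (size x))%N /\
      tm_cfg M x n = Some c /\ tm_step M c = None /\ cf_output c = f x.

Definition PSPACE_hard (P : seq bool -> Prop) : Prop :=
  forall L : seq bool -> Prop, in_PSPACE L ->
    exists f, poly_time_computable f /\ forall x, L x <-> P (f x).

(* Main.v *)
(* Let M decide L in polynomial space. A rejecting history of M on x is a prefix of the sequence
   of configurations of M on x, all padded to the same polynomial length, in which a halted
   configuration shows up that does not accept; one exists iff x is not in L. Let # be a new letter
   and let T accept the words none of whose #-free blocks is a rejecting history: a block with no
   rejecting letter, with a wrong initial configuration, or with a letter that does not follow
   from its neighbourhood one configuration earlier is recognized by polynomially many states.

   If x is in L, then T accepts every word and the Hausdorff value is 0. If u is a rejecting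
   history, no accepted word has the factor #u#, so that every edit path starting from (#u#)^n has
   an edit in each of the n blocks and normalized weight at least 1/(|u|+3). Hence nu = 0 works.

   To compute T in polynomial time, the positions in a configuration are numbered by vectors of
   input positions, and the name of a state spells this vector in one-hot binary digits. The
   encoding of T is then the output of a program with nested loops over the input positions,
   tests of the cells that the loop variables point at, and output instructions. Such a program
   is run by a Turing machine that keeps the input, with the loop variables as marks on its
   cells, in a work zone at the left end of the tape and appends the output behind that zone. *)

Require Import Defs.
From HB Require Import structures.
From mathcomp Require Import all_boot all_order all_algebra.
From mathcomp Require Import all_classical all_reals.
From mathcomp Require Import ereal topology normedtype sequences Rstruct Rstruct_topology.
From Stdlib Require PArith NArith Nnat Pnat.
From mathcomp Require Import zify.
Set Implicit Arguments.
Unset Strict Implicit.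
Unset Printing Implicit Defensive.

(** * Runs of Turing machines *)

Definition steps (M : TM) (n : nat) (c c' : config) : Prop :=
  iter n (obind (tm_step M)) (Some c) = Some c'.

Lemma steps_trans M n m c c' c'' :
  steps M n c c' -> steps M m c' c'' -> steps M (n + m) c c''.
Proof. by rewrite /steps => h h'; rewrite addnC iterD h. Qed.

Lemma steps1 M c c' : tm_step M c = Some c' -> steps M 1 c c'.
Proof. by []. Qed.

Lemma stepsS M n c c' c'' :
  tm_step M c = Some c' -> steps M n c' c'' -> steps M n.+1 c c''.
Proof. by move=> h; rewrite -add1n; apply: steps_trans. Qed.

(* [r] is the tape from the head onwards; [[::]] and [[:: 0]] denote the same configuration. *)
Definition cfg (q : nat) (l r : seq nat) : config :=
  if r is a :: r' then Config q l a r' else Config q l 0 [::].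

Lemma stepR M q l a r q' b :
  tm_delta M q a = Some (q', b, true) ->
  tm_step M (cfg q l (a :: r)) = Some (cfg q' (b :: l) r).
Proof. by rewrite /tm_step /= => ->; case: r. Qed.

Lemma stepL M q h l a r q' b :
  tm_delta M q a = Some (q', b, false) ->
  tm_step M (cfg q (h :: l) (a :: r)) = Some (cfg q' l (h :: b :: r)).
Proof. by rewrite /tm_step /= => ->. Qed.

Lemma stepL0 M q a r q' b :
  tm_delta M q a = Some (q', b, false) ->
  tm_step M (cfg q [::] (a :: r)) = Some (cfg q' [::] (b :: r)).
Proof. by rewrite /tm_step /= => ->. Qed.

(** * Turing machines for sweeping programs *)

Section Compiler.

Variable V : finType.

(* A work cell: is it the leftmost one, its input bit, and which loop variables point at it. *)
Definition cell := (bool * option bool * {ffun V -> bool})%type.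

Definition lft (c : cell) := c.1.1.

(** The symbols 0, 1 and 2 remain the blank and the two bits, in which the input is given and the
    output is written. *)
Definition enc_cell (c : cell) : nat := 3 + index c (enum {: cell}).

Definition dec_cell (a : nat) : option cell :=
  if a < 3 then None else onth (enum {: cell}) (a - 3).

Definition nsyms := 3 + #|{: cell}|.

Lemma enc_cellK c : dec_cell (enc_cell c) = Some c.
Proof.
rewrite /dec_cell /enc_cell /= addKn onthE (nth_map c) ?nth_index ?mem_enum //.
by rewrite index_mem mem_enum.
Qed.

Lemma enc_cell_lt c : enc_cell c < nsyms.
Proof. by rewrite /nsyms ltn_add2l cardE index_mem mem_enum. Qed.

Definition bit_of_sym (a : nat) : option bool :=
  if a == 1 then Some false else if a == 2 then Some true else None.

Lemma sym_of_bitK b : bit_of_sym (sym_of_bit b) = Some b.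
Proof. by case: b. Qed.

(** [IInit] turns the input into a work zone, [IHalt] stops behind that zone, and [IEmit b t]
    appends [b] to the output and jumps to [t]. [ISweep f t1 t0] rewrites the marks of the work
    cells from left to right while [f] carries one bit, whose final value selects the jump
    target. *)
Inductive instr :=
  | IInit
  | IHalt
  | IEmit of bool & nat
  | ISweep of (bool -> cell -> bool * {ffun V -> bool}) & nat & nat.

(** A left move on the leftmost cell stays there, so [q'] takes over with the head at the left
    end. *)
Definition ret (q q' a : nat) :=
  Some (if dec_cell a is Some c then if lft c then q' else q else q, a, false).

(* The machine state is [4 * pc + m]; [m] is a phase of the current instruction:
   0, 1 move right, 2, 3 return to the leftmost cell. *)
Definition delta (C : seq instr) (q a : nat) : option (nat * nat * bool) :=
  let pc := q %/ 4 in let m := q %% 4 in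
  match nth IHalt C pc with
  | IInit =>
      if m < 2 then
        Some (if a == 0 then 2 else 1,
              enc_cell (m == 0, bit_of_sym a, [ffun=> false]), true)
      else if m == 2 then
        Some (3, enc_cell (false, None, [ffun=> false]), false)
      else ret 3 4 a
  | IHalt => if dec_cell a is Some c then Some (q, a, true) else None
  | IEmit b t =>
      if m < 2 then
        if a == 0 then Some (4 * pc + 2, sym_of_bit b, false)
        else Some (q, a, true)
      else ret q (4 * t) a
  | ISweep f t1 t0 =>
      if m < 2 then
        if dec_cell a is Some c then
          let r := f (m == 1) c in Some (4 * pc + r.1, enc_cell (c.1, r.2), true)
        else Some (4 * pc + 2 + (m == 1), a, false)
      else ret q (4 * (if m == 3 then t1 else t0)) a
  end.

Definition machine (C : seq instr) : TM :=
  MkTM (4 * size C) nsyms 0 0 (delta C).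

Definition targets_lt (K : nat) (i : instr) : bool :=
  match i with
  | IInit => 1 < K
  | IHalt => true
  | IEmit _ t => t < K
  | ISweep _ t1 t0 => (t1 < K) && (t0 < K)
  end.

Lemma machine_wf (C : seq instr) :
  0 < size C -> all (targets_lt (size C)) C -> tm_wf (machine C).
Proof.
move=> C0 /(all_nthP IHalt) allC; do 3 (split; first by rewrite /= /nsyms; lia).
move=> q a /= qC aC; have pcC : q %/ 4 < size C by lia.
have := allC _ pcC; rewrite /delta /ret; have mlt : q %% 4 < 4 by lia.
case: (nth _ _ _) => [||b t|f t1 t0] /=.
- move=> C1; case: ifP => _; first by split; [case: ifP; lia | apply: enc_cell_lt].
  case: ifP => _; first by split; [lia | apply: enc_cell_lt].
  by split => //; case: (dec_cell a) => [c|]; [case: ifP|]; lia.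
- by move=> _; case: (dec_cell a).
- move=> tC; case: ifP => _.
    case: ifP => _; split => //; first by lia.
    by rewrite /nsyms; case: b => /=; lia.
  by split => //; case: (dec_cell a) => [c|]; [case: ifP|]; lia.
- case/andP=> t1C t0C; case: ifP => _.
    case: (dec_cell a) => [c|]; split => //; try exact: enc_cell_lt.
      by case: (f _ _).1; lia.
    by case: (_ == _); lia.
  by split => //; case: (dec_cell a) => [c|]; [case: ifP => _; [case: ifP|]|]; lia.
Qed.

Definition nonleft (a : nat) := if dec_cell a is Some c then ~~ lft c else true.

(** One step for [a], one for each symbol of [l], and one on the leftmost cell itself, where the
    head stays. *)
Lemma return_left C q q' c0 l a r :
  (forall a, delta C q a = ret q q' a) ->
  lft c0 -> all nonleft (a :: l) ->
  steps (machine C) (size l).+2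
    (cfg q (rcons l (enc_cell c0)) (a :: r)) (cfg q' [::] (enc_cell c0 :: catrev l (a :: r))).
Proof.
move=> dq c0l; elim: l a r => [|b l IH] a r /= /andP[al].
  move=> _; apply: stepsS.
    apply: (@stepL _ _ _ _ _ _ q a); rewrite /= dq /ret.
    by move: al; rewrite /nonleft; case: (dec_cell a) => [c /negbTE ->|].
  apply/steps1/stepL0; by rewrite /= dq /ret enc_cellK c0l.
move=> bl; apply: stepsS; last exact: IH.
apply: stepL; rewrite /= dq /ret.
by move: al; rewrite /nonleft; case: (dec_cell a) => [c /negbTE ->|].
Qed.

Lemma nonleft_bit b : nonleft (sym_of_bit b).
Proof. by case: b. Qed.

Fixpoint sweep (f : bool -> cell -> bool * {ffun V -> bool}) (s : bool) (W : seq cell) :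
    bool * seq cell :=
  if W is c :: W' then
    let r := f s c in let rw := sweep f r.1 W' in (rw.1, (c.1, r.2) :: rw.2)
  else (s, [::]).

Lemma sweep_right C pc f t1 t0 (s : bool) l W r :
  nth IHalt C pc = ISweep f t1 t0 ->
  steps (machine C) (size W)
    (cfg (4 * pc + s) l (map enc_cell W ++ r))
    (cfg (4 * pc + (sweep f s W).1) (catrev (map enc_cell (sweep f s W).2) l) r).
Proof.
move=> Cpc; elim: W s l => [//|c W IH] s l; rewrite [map _ _]/= [_ ++ _]/=.
apply: stepsS; last exact: IH.
apply: stepR; rewrite /= /delta.
have -> : (4 * pc + s) %/ 4 = pc by case: s; lia.
have -> : (4 * pc + s) %% 4 = s by case: s; lia.
by rewrite Cpc enc_cellK; case: s.
Qed.

Definition work_zone (W : seq cell) :=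
  if W is c :: W' then lft c && all (fun c => ~~ lft c) W' else false.

(** The [z] trailing blanks come from cells visited earlier; their number is an artefact of the run,
    so sweeps and emissions leave the new one existential. *)
Definition tape (W : seq cell) (O : seq bool) (z : nat) : seq nat :=
  map enc_cell W ++ map sym_of_bit O ++ nseq z 0.

Lemma work_zone_sweep f s W : work_zone W -> work_zone (sweep f s W).2.
Proof.
rewrite /work_zone /lft; case: W => //= c W /andP[-> /=]; move: (f s c).1 => {}s.
by elim: W s => //= c' W IH s /andP[-> /=] /IH.
Qed.

Lemma size_sweep f s W : size (sweep f s W).2 = size W.
Proof. by elim: W s => //= c W IH s; rewrite IH. Qed.

Lemma run_sweep C pc f t1 t0 W O z :
  nth IHalt C pc = ISweep f t1 t0 -> work_zone W ->
  exists z', steps (machine C) (2 * size W).+1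
    (cfg (4 * pc) [::] (tape W O z))
    (cfg (4 * (if (sweep f false W).1 then t1 else t0)) [::]
      (tape (sweep f false W).2 O z')).
Proof.
move=> Cpc Wz.
pose r := map sym_of_bit O ++ nseq z 0.
(* The sweep ends on a first symbol [a] behind the zone. If the tape is exhausted there, a blank is
   read, which then counts as one trailing blank. *)
have [z' [a [r' [cr er aa]]]] : exists z' a r', [/\ (forall q l, cfg q l r = cfg q l (a :: r')),
    map sym_of_bit O ++ nseq z' 0 = a :: r' & dec_cell a = None].
  rewrite /r; case: O {r} => [|b O]; last first.
    by exists z, (sym_of_bit b), (map sym_of_bit O ++ nseq z 0); split => //; case: b.
  case: z => [|z]; first by exists 1, 0, [::].
  by exists z.+1, 0, (nseq z 0).
exists z'.
have := @sweep_right C pc f t1 t0 false [::] W r Cpc; rewrite addn0 => h.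
rewrite mul2n -addnn -addnS; apply: (steps_trans h).
have := work_zone_sweep f false Wz; have := size_sweep f false W.
case: (sweep f false W) => s W2 /= sW2 W2z; rewrite cr /tape er {h}.
case/lastP: W2 sW2 W2z => // W2 c; rewrite size_rcons => <- W2z.
rewrite map_rcons catrevE rev_rcons /= cats0 -addn1 addnC add1n.
have delq b : delta C (4 * pc + 2 + s) b = ret (4 * pc + 2 + s) (4 * (if s then t1 else t0)) b.
  rewrite /delta.
  have -> : (4 * pc + 2 + s) %/ 4 = pc by case: s; lia.
  have -> : (4 * pc + 2 + s) %% 4 = 2 + s by case: s; lia.
  by rewrite Cpc; case: s.
apply: (@stepsS _ _ _ (cfg (4 * pc + 2 + s) (rev (map enc_cell W2)) (enc_cell c :: a :: r'))).
  apply: stepL; rewrite /= /delta.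
  have -> : (4 * pc + s) %/ 4 = pc by case: (s); lia.
  have -> : (4 * pc + s) %% 4 = s by case: (s); lia.
  by rewrite Cpc aa; case: (s).
case: W2 W2z => [|c0 W2] /=.
  by move=> /andP[cl _]; apply/steps1/stepL0; rewrite /= delq /ret enc_cellK cl.
rewrite all_rcons => /andP[cl0 /andP[cl Wl]].
have := @return_left C _ _ c0 (rev (map enc_cell W2)) (enc_cell c) (a :: r') delq cl0.
rewrite size_rev size_map rev_cons catrevE revK cat_rcons; apply.
rewrite /= /nonleft enc_cellK cl /= all_rev.
by apply/allP => _ /mapP[d /(allP Wl) dl ->]; rewrite enc_cellK.
Qed.

Lemma emit_right C pc b t l u r :
  nth IHalt C pc = IEmit b t -> all (fun a => a != 0) u ->
  steps (machine C) (size u) (cfg (4 * pc) l (u ++ r)) (cfg (4 * pc) (catrev u l) r).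
Proof.
move=> Cpc; elim: u l => [//|a u IH] l /andP[/negbTE a0 u0].
apply: stepsS; last exact: IH.
apply: stepR; rewrite /= /delta.
have -> : (4 * pc) %/ 4 = pc by lia.
have -> : (4 * pc) %% 4 = 0 by lia.
by rewrite Cpc a0.
Qed.

Lemma run_emit C pc b t W O z :
  nth IHalt C pc = IEmit b t -> work_zone W ->
  exists z', steps (machine C) (2 * (size W + size O)).+1
    (cfg (4 * pc) [::] (tape W O z)) (cfg (4 * t) [::] (tape W (rcons O b) z')).
Proof.
(* The new bit overwrites the first trailing blank, if there is one. *)
move=> Cpc Wz; exists z.-1.
pose u := map enc_cell W ++ map sym_of_bit O.
have u0 : all (fun a => a != 0) u.
  rewrite all_cat; apply/andP; split; apply/allP => _ /mapP[c _ ->] //.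
  by case: c.
have := @emit_right C pc b t [::] u (nseq z 0) Cpc u0.
rewrite size_cat !size_map {2}/u -catA => h.
rewrite mul2n -addnn -addnS; apply: (steps_trans h) => {h}.
have -> : cfg (4 * pc) (catrev u [::]) (nseq z 0) = cfg (4 * pc) (rev u) (0 :: nseq z.-1 0).
  by case: z.
have delq a : delta C (4 * pc + 2) a = ret (4 * pc + 2) (4 * t) a.
  rewrite /delta.
  have -> : (4 * pc + 2) %/ 4 = pc by lia.
  have -> : (4 * pc + 2) %% 4 = 2 by lia.
  by rewrite Cpc.
have -> : size W + size O = size u by rewrite size_cat !size_map.
have -> : tape W (rcons O b) z.-1 = u ++ sym_of_bit b :: nseq z.-1 0.
  by rewrite /tape map_rcons cat_rcons catA.
have [c0 [u' [eu c0l u'l]]] : exists c0 u', [/\ u = enc_cell c0 :: u', lft c0 & all nonleft u'].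
  rewrite /u; case: (W) Wz => // c0 W' /andP[c0l W'l].
  exists c0, (map enc_cell W' ++ map sym_of_bit O); split=> //.
  rewrite all_cat; apply/andP; split; apply/allP => _ /mapP[c cW ->].
    by rewrite /nonleft enc_cellK; apply: (allP W'l).
  exact: nonleft_bit.
rewrite {}eu {u0 u}.
have dpc : delta C (4 * pc) 0 = Some (4 * pc + 2, sym_of_bit b, false).
  rewrite /delta.
  have -> : (4 * pc) %/ 4 = pc by lia.
  have -> : (4 * pc) %% 4 = 0 by lia.
  by rewrite Cpc.
case/lastP: u' u'l => [|u a] ul.
  apply: stepsS; first by rewrite rev_cons /=; apply: (stepL (M := machine C)); exact: dpc.
  by apply/steps1/stepL0; rewrite /= delq /ret enc_cellK c0l.
rewrite [size (_ :: _)]/= size_rcons; apply: stepsS.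
  by rewrite rev_cons rev_rcons /=; apply: (stepL (M := machine C)); exact: dpc.
have := @return_left C _ _ c0 (rev u) a (sym_of_bit b :: nseq z.-1 0) delq c0l.
rewrite size_rev catrevE revK -cat_rcons; apply.
by move: ul; rewrite all_rcons /= all_rev.
Qed.

Lemma bits_prefixK O z : bits_prefix (map sym_of_bit O ++ nseq z 0) = O.
Proof. by elim: O => [|b O IH] /=; [case: z | case: b; rewrite /= IH]. Qed.

(** [cf_output] reads from the head rightwards, so the machine has to stop on the first symbol
    behind the work zone. *)
Lemma run_halt C pc W O z :
  nth IHalt C pc = IHalt ->
  exists c, [/\ steps (machine C) (size W) (cfg (4 * pc) [::] (tape W O z)) c,
    tm_step (machine C) c = None & cf_output c = O].
Proof.
move=> Cpc.
have q4 : (4 * pc) %/ 4 = pc by lia.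
exists (cfg (4 * pc) (catrev (map enc_cell W) [::]) (map sym_of_bit O ++ nseq z 0)); split.
- rewrite /tape; elim: W [::] => [//|c W IH] l.
  apply: stepsS; last exact: IH.
  by apply: stepR; rewrite /= /delta q4 Cpc enc_cellK.
- rewrite /tm_step; case: O => [|b O]; [case: z => [|z]|]; rewrite /= /delta q4 Cpc //.
  by case: b.
- rewrite /cf_output /cfg -[RHS](bits_prefixK O z).
  by case: (_ ++ _).
Qed.

Fixpoint input_cells (fst : bool) (x : seq bool) : seq cell :=
  (fst, ohead x, [ffun=> false]) :: (if x is _ :: x' then input_cells false x' else [::]).

Lemma size_input_cells fst x : size (input_cells fst x) = (size x).+1.
Proof. by elim: x fst => //= b x IH fst; rewrite IH. Qed.

Lemma init_right C (fst : bool) l x :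
  nth IHalt C 0 = IInit ->
  steps (machine C) (size x).+1 (cfg (~~ fst) l (map sym_of_bit x))
    (cfg 2 (catrev (map enc_cell (input_cells fst x)) l) [::]).
Proof.
move=> C0.
have d a : delta C (~~ fst) a = Some (if a == 0 then 2 else 1,
   enc_cell (fst, bit_of_sym a, [ffun=> false]), true).
  by rewrite /delta; case: (fst); rewrite /= C0.
elim: x fst l d => [|b x IH] fst l d.
  by apply/steps1/(stepR _ [::]); exact: d.
apply: stepsS; last first.
  apply: (IH false) => a.
  by rewrite /delta /= C0.
by apply: stepR; rewrite /= d sym_of_bitK; case: b.
Qed.

(** The sweep to the right also turns the first blank into a cell, and phase 2 adds one more:
    [size x + 2] cells in all. *)
Lemma run_init C x :
  nth IHalt C 0 = IInit ->
  steps (machine C) (2 * size x + 3) (tm_init (machine C) x)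
    (cfg 4 [::] (tape (rcons (input_cells true x) (false, None, [ffun=> false])) [::] 0)).
Proof.
move=> C0.
have -> : tm_init (machine C) x = cfg 0 [::] (map sym_of_bit x).
  by rewrite /tm_init /cfg; case: (map _ _).
have -> : 2 * size x + 3 = (size x).+1 + (size x).+2 by lia.
apply: (steps_trans (init_right true [::] x C0)).
have dq a : delta C 3 a = ret 3 4 a by rewrite /delta /= C0.
have d0 : delta C 2 0 = Some (3, enc_cell (false, None, [ffun=> false]), false).
  by rewrite /delta /= C0.
rewrite /tape cats0 map_rcons catrevE cats0.
set e := enc_cell (false, _, _).
have [u [eu ul su]] : exists u, [/\ input_cells true x = (true, ohead x, [ffun=> false]) :: u,
    all (fun c => ~~ lft c) u & size u = size x].
  have wf fst y : input_cells fst y = (fst, ohead y, [ffun=> false]) :: behead (input_cells fst y).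
    by case: y.
  exists (behead (input_cells true x)); split; first exact: wf.
    case: x => //= _ x; elim: x => //.
  by rewrite size_behead size_input_cells.
rewrite eu; case/lastP: u ul su {eu} => [|u c] ul <-.
  rewrite /=; apply: stepsS; first by apply: (@stepL (machine C) _ _ _ _ [::]); exact: d0.
  by apply/steps1/stepL0; rewrite /= dq /ret enc_cellK.
rewrite size_rcons map_cons rev_cons map_rcons rev_rcons.
apply: stepsS; first by apply: (@stepL (machine C) _ _ _ _ [::]); exact: d0.
have := @return_left C _ _ (true, ohead x, [ffun=> false]) (rev (map enc_cell u)) (enc_cell c)
  [:: e] dq isT.
rewrite size_rev size_map catrevE revK.
have -> : map (@enc_cell) u ++ [:: enc_cell c; e] = rcons (rcons (map enc_cell u) (enc_cell c)) e.
  by rewrite -!cats1 -catA.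
apply.
move: ul; rewrite all_rcons /= all_rev {1}/nonleft enc_cellK => /andP[-> ul].
by apply/allP => _ /mapP[d /(allP ul) dl ->]; rewrite /nonleft enc_cellK.
Qed.

End Compiler.

(** * Loop programs *)

Section LoopPrograms.

Variable V : finType.

Inductive prog :=
  | PEmit of seq bool
  | PSeq of prog & prog
  | PFor of V & prog
  | PIf of (cell V -> bool) & prog & prog.

Definition env := {ffun V -> nat}.

Definition upd (e : env) (v : V) (k : nat) : env := [ffun w => if w == v then k else e w].

(* At least 2, so that powers of it dominate every polynomial bound, even for an empty input. *)
Definition zone_size (x : seq bool) := size x + 2.

Definition cell_at (x : seq bool) (e : env) (k : nat) : cell V :=
  (k == 0, onth x k, [ffun v => e v == k]).

Definition zone (x : seq bool) (e : env) : seq (cell V) :=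
  [seq cell_at x e k | k <- iota 0 (zone_size x)].

Fixpoint out (x : seq bool) (p : prog) (e : env) : seq bool :=
  match p with
  | PEmit s => s
  | PSeq p q => out x p e ++ out x q e
  | PFor v p => flatten [seq out x p (upd e v k) | k <- iota 0 (zone_size x)]
  | PIf P p q => if has P (zone x e) then out x p e else out x q e
  end.

(* A variable is idle when it points beyond the work zone. *)
Definition idle_env (x : seq bool) : env := [ffun=> zone_size x].

(** A loop must not reuse the variable of an enclosing loop, since its variable has to be idle on
    entry. *)
Fixpoint well_scoped (used : seq V) (p : prog) : bool :=
  match p with
  | PEmit _ => true
  | PSeq p q | PIf _ p q => well_scoped used p && well_scoped used q
  | PFor v p => (v \notin used) && well_scoped (v :: used) p
  end.

(** Moves the mark of [v] one cell to the right: [s] tells whether the previous cell had it, and [b]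
    is what the leftmost cell receives. The final bit tells whether the mark has left the zone. *)
Definition shift (v : V) (b s : bool) (c : cell V) : bool * {ffun V -> bool} :=
  (c.2 v, [ffun w => if w == v then (if lft c then b else s) else c.2 w]).

Definition test (P : cell V -> bool) (s : bool) (c : cell V) : bool * {ffun V -> bool} :=
  (s || P c, c.2).

Fixpoint code_size (p : prog) : nat :=
  match p with
  | PEmit s => size s
  | PSeq p q => code_size p + code_size q
  | PFor v p => (code_size p).+2
  | PIf P p q => (code_size p + code_size q).+2
  end.

(** [o] is the address of the first instruction. A loop puts its mark on the leftmost cell, and
    after the body a second sweep moves the mark on and jumps back unless the mark has left the
    zone. The second sweep of a conditional only serves as a jump over the other branch. *)
Fixpoint compile (p : prog) (o : nat) : seq (instr V) :=
  match p with
  | PEmit s => [seq IEmit V ib.1 ib.2 | ib <- zip s (iota o.+1 (size s))]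
  | PSeq p q => compile p o ++ compile q (o + code_size p)
  | PFor v p =>
      ISweep (shift v true) o.+1 o.+1 :: compile p o.+1 ++
      [:: ISweep (shift v false) (o + (code_size p).+2) o.+1]
  | PIf P p q =>
      ISweep (test P) o.+1 (o + (code_size p).+2) :: compile p o.+1 ++
      ISweep (test P) (o + (code_size p + code_size q).+2) (o + (code_size p + code_size q).+2)
      :: compile q (o + (code_size p).+2)
  end.

Lemma size_compile p o : size (compile p o) = code_size p.
Proof.
elim: p o => [s|p IHp q IHq|v p IHp|P p IHp q IHq] o /=.
- by rewrite size_map size_zip size_iota minnn.
- by rewrite size_cat IHp IHq.
- by rewrite size_cat IHp addn1.
- by rewrite size_cat /= IHp IHq addnS.
Qed.

Lemma compile_targets p o K :
  o + code_size p < K -> all (targets_lt K) (compile p o).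
Proof.
elim: p o K => [s|p IHp q IHq|v p IHp|P p IHp q IHq] o K /= oK.
- rewrite all_map; elim: s o oK => //= b s IH o oK.
  by rewrite IH ?andbT; lia.
- by rewrite all_cat IHp ?IHq //; lia.
- by rewrite /= all_cat /= IHp //; lia.
- by rewrite /= all_cat /= IHp ?IHq //; lia.
Qed.

(** One bound for both the number of executed instructions and the length of the output, for a zone
    of [N] cells. *)
Fixpoint cost (p : prog) (N : nat) : nat :=
  match p with
  | PEmit s => size s
  | PSeq p q => cost p N + cost q N
  | PFor v p => 1 + N * (cost p N).+1
  | PIf P p q => 2 + (cost p N + cost q N)
  end.

Lemma size_out x p e : size (out x p e) <= cost p (zone_size x).
Proof.
elim: p e => [s|p IHp q IHq|v p IHp|P p IHp q IHq] e //=.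
- by rewrite size_cat leq_add.
- rewrite size_flatten /shape -map_comp sumnE big_map.
  apply: (@leq_trans (\sum_(k <- iota 0 (zone_size x)) cost p (zone_size x))).
    by apply: leq_sum => k _; apply: IHp.
  by rewrite big_const_seq count_predT size_iota iter_addn_0; lia.
- by case: ifP => _; have := IHp e; have := IHq e; lia.
Qed.

Lemma sweep_test P s W : sweep (test P) s W = (s || has P W, W).
Proof.
by elim: W s => [|c W IH] s /=; rewrite ?orbF // IH /= orbA; case: c => -[].
Qed.

(** The induction runs over suffixes of the zone; the bit carried into cell [k] says whether the
    mark was on the cell before it. *)
Lemma sweep_shift x (e : env) v b k m :
  sweep (shift v b) (if k is k'.+1 then e v == k' else false)
    [seq cell_at x e i | i <- iota k m] =
  ((if k + m is k'.+1 then e v == k' else false),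
   [seq (i == 0, onth x i,
         [ffun w => if w == v then (if i is i'.+1 then e v == i' else b) else e w == i])
     | i <- iota k m]).
Proof.
elim: m k => [|m IH] k; first by rewrite addn0.
rewrite [LHS]/= {1 2}ffunE.
have := IH k.+1; rewrite /cell_at => ->.
rewrite addSnnS /=; congr (_, _ :: _); congr (_, _).
by apply/ffunP => w; rewrite !ffunE /lft; case: eqP => // _; case: k {IH}.
Qed.

Lemma zone_shift_in x (e : env) v :
  e v = zone_size x -> (sweep (shift v true) false (zone x e)).2 = zone x (upd e v 0).
Proof.
move=> ev; rewrite (@sweep_shift x e v true 0) /= /zone; apply/eq_in_map => i.
rewrite mem_iota /= => ilt; rewrite /cell_at; congr (_, _).
apply/ffunP => w; rewrite !ffunE; case: eqP => // _.
by case: i ilt => // i; rewrite ev /zone_size; lia.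
Qed.

(** When the mark leaves the last cell, number [(size x).+1], the new value of [v] is [zone_size x],
    the idle one. Hence a loop ends in the environment in which it started. *)
Lemma zone_shift x e v k :
  sweep (shift v false) false (zone x (upd e v k)) =
  (k == (size x).+1, zone x (upd e v k.+1)).
Proof.
rewrite (@sweep_shift x _ v false 0); congr (_, _).
  by rewrite add0n /zone_size addn2 /= ffunE eqxx.
apply: eq_map => i; rewrite /cell_at; congr (_, _).
apply/ffunP => w; rewrite !ffunE; case: (altP (w =P v)) => // _.
by case: i => // i; rewrite eqxx.
Qed.

Lemma upd_id (e : env) v : upd e v (e v) = e.
Proof. by apply/ffunP => w; rewrite ffunE; case: eqP => [->|]. Qed.

Lemma work_zone_zone x e : work_zone (zone x e).
Proof.
rewrite /work_zone /zone /zone_size addn2 /=; apply/allP => _ /mapP[k kx ->].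
by move: kx; rewrite mem_iota /lft /=; case: k.
Qed.

Lemma nth_at (C c1 c2 : seq (instr V)) i : C = c1 ++ i :: c2 -> nth (IHalt V) C (size c1) = i.
Proof. by move=> ->; rewrite nth_cat ltnn subnn. Qed.

(** Each instruction crosses the work zone, and possibly the output, once in each direction. As [L]
    bounds the output at all times, it takes at most [2 * (zone_size x + L) + 1] steps. *)
Lemma run_compile (C c1 c2 : seq (instr V)) x p (e : env) O z used L :
  C = c1 ++ compile p (size c1) ++ c2 -> well_scoped used p ->
  (forall v, v \notin used -> e v = zone_size x) ->
  size (O ++ out x p e) <= L ->
  exists n z', n <= cost p (zone_size x) * (2 * (zone_size x + L)).+1 /\
    steps (machine C) n (cfg (4 * size c1) [::] (tape (zone x e) O z))
      (cfg (4 * (size c1 + code_size p)) [::] (tape (zone x e) (O ++ out x p e) z')).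
Proof.
set N := zone_size x; set B := (2 * (N + L)).+1.
have szz e' : size (zone x e') = N by rewrite size_map size_iota.
have LB k : k <= L -> (2 * (N + k)).+1 <= B by rewrite /B; lia.
have NB : (2 * N).+1 <= B by have := LB 0 isT; rewrite addn0.
clearbody B; elim: p c1 c2 e O z used => [s|p IHp q IHq|v p IHp|P p IHp q IHq] c1 c2 e O z used.
- elim: s c1 O z => [|b s IH] c1 O z eC _ eN OL.
    by exists 0, z; rewrite addn0 cats0.
  have Ci := nth_at eC.
  have [z1 r1] := run_emit O z Ci (work_zone_zone x e).
  have [||||n [z2 [n2 r2]]] := IH (rcons c1 (IEmit V b (size c1).+1)) (rcons O b) z1 => //.
  + by rewrite eC /= cat_rcons size_rcons.
  + by rewrite cat_rcons.
  exists ((2 * (size (zone x e) + size O)).+1 + n), z2; split.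
    move: OL n2; rewrite szz size_cat /= mulSn => OL; have /LB : size O <= L by lia.
    by lia.
  apply: (steps_trans r1); move: r2; rewrite size_rcons /= cat_rcons.
  by rewrite addSnnS.
- move=> eC /= /andP[wp wq] eN OL.
  have [||||n [z1 [n1 r1]]] := IHp c1 (compile q (size c1 + code_size p) ++ c2) e O z used => //.
  + by rewrite eC /= -!catA.
  + by move: OL; rewrite !size_cat; lia.
  have sC : size (c1 ++ compile p (size c1)) = size c1 + code_size p.
    by rewrite size_cat size_compile.
  have [||||m [z2 [m2 r2]]] := IHq (c1 ++ compile p (size c1)) c2 e (O ++ out x p e) z1 used => //.
  + by rewrite eC /= sC -!catA.
  + by rewrite -catA.
  exists (n + m), z2; split; first by rewrite mulnDl leq_add.
  by apply: (steps_trans r1); move: r2; rewrite sC -!catA addnA.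
- move=> eC /= /andP[vused wp] eN OL.
  have Ci := nth_at eC.
  have [z1] := run_sweep O z Ci (work_zone_zone x e).
  rewrite zone_shift_in ?eN // if_same szz => r1.
  pose c1' := rcons c1 (ISweep (shift v true) (size c1).+1 (size c1).+1).
  pose i2 := ISweep (shift v false) (size c1 + (code_size p).+2) (size c1).+1.
  have sc1' : size c1' = (size c1).+1 by rewrite size_rcons.
  have eC1 : C = c1' ++ compile p (size c1') ++ (i2 :: c2).
    by rewrite sc1' cat_rcons eC /= -catA.
  have eC2 : C = (c1' ++ compile p (size c1')) ++ i2 :: c2 by rewrite -catA.
  have Ci2 := nth_at eC2.
  have sC2 : size (c1' ++ compile p (size c1')) = size c1' + code_size p.
    by rewrite size_cat size_compile.
  (* The loop from the entry of its body on, with the mark on cell [k] and [m.+1] passes to go. *)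
  have loop m k O' z0 : k + m.+1 = N ->
      size (O' ++ flatten [seq out x p (upd e v i) | i <- iota k m.+1]) <= L ->
      exists n z', n <= m.+1 * (cost p N).+1 * B /\
        steps (machine C) n (cfg (4 * size c1') [::] (tape (zone x (upd e v k)) O' z0))
          (cfg (4 * (size c1 + (code_size p).+2)) [::]
             (tape (zone x e) (O' ++ flatten [seq out x p (upd e v i) | i <- iota k m.+1]) z')).
    elim: m k O' z0 => [|m IHm] k O' z0 kN O'L.
      have [||||n [z2 [n2 r2]]] := IHp c1' (i2 :: c2) (upd e v k) O' z0 (v :: used) => //.
      + by move=> w; rewrite inE negb_or ffunE => /andP[/negbTE ->]; apply: eN.
      + by move: O'L; rewrite /= cats0.
      have [z3] := run_sweep (O' ++ out x p (upd e v k)) z2 Ci2 (work_zone_zone x (upd e v k)).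
      rewrite zone_shift szz /=.
      have -> : k == (size x).+1 by move: kN; rewrite /N /zone_size; lia.
      have -> : upd e v k.+1 = e by rewrite -[RHS](upd_id e v) eN // -/N -kN addn1.
      rewrite sC2 => r3.
      exists (n + (2 * N).+1), z3; split.
        by rewrite mul1n mulSn; lia.
      by rewrite cats0; apply: (steps_trans r2 r3).
    have [||||n [z2 [n2 r2]]] := IHp c1' (i2 :: c2) (upd e v k) O' z0 (v :: used) => //.
    + by move=> w; rewrite inE negb_or ffunE => /andP[/negbTE ->]; apply: eN.
    + by move: O'L; rewrite /= !size_cat; lia.
    have [z3] := run_sweep (O' ++ out x p (upd e v k)) z2 Ci2 (work_zone_zone x (upd e v k)).
    rewrite zone_shift szz /=.
    have -> : (k == (size x).+1) = false by move: kN; rewrite /N /zone_size; lia.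
    rewrite sC2 => r3.
    have [||n' [z4 [n4 r4]]] := IHm k.+1 (O' ++ out x p (upd e v k)) z3.
    + by rewrite -kN addSnnS.
    + by move: O'L; rewrite -catA.
    exists (n + (2 * N).+1 + n'), z4; split.
      have -> : m.+2 * (cost p N).+1 * B = B + cost p N * B + m.+1 * (cost p N).+1 * B.
        by rewrite -mulSn -mulnDl -mulSn.
      by lia.
    apply: steps_trans (steps_trans r2 r3) _.
    by move: r4; rewrite sc1' -!catA.
  have [||n [z2 [n2 r2]]] := loop (size x).+1 0 O z1.
  + by rewrite /N /zone_size addn2.
  + by move: OL; rewrite /N /zone_size addn2.
  exists ((2 * N).+1 + n), z2; split.
    by move: n2; rewrite mulnDl mul1n -(addn2 (size x)) => n2; rewrite leq_add.
  by apply: (steps_trans r1); move: r2; rewrite sc1' /N /zone_size addn2.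
- move=> eC /= /andP[wp wq] eN OL.
  have Ci := nth_at eC.
  have [z1] := run_sweep O z Ci (work_zone_zone x e).
  rewrite sweep_test szz /= => r1.
  pose a := size c1 + (code_size p + code_size q).+2.
  pose i1 := ISweep (test P) (size c1).+1 (size c1 + (code_size p).+2).
  pose i2 := ISweep (test P) a a.
  pose c1' := rcons c1 i1.
  have sc1' : size c1' = (size c1).+1 by rewrite size_rcons.
  pose c3 := rcons (c1' ++ compile p (size c1')) i2.
  have sc3 : size c3 = size c1 + (code_size p).+2.
    by rewrite size_rcons size_cat size_compile sc1'; lia.
  have eC1 : C = c1' ++ compile p (size c1') ++ (i2 :: compile q (size c3) ++ c2).
    by rewrite sc1' sc3 cat_rcons eC /= -catA.
  have eC2 : C = (c1' ++ compile p (size c1')) ++ i2 :: compile q (size c3) ++ c2.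
    by rewrite -catA.
  have eC3 : C = c3 ++ compile q (size c3) ++ c2 by rewrite cat_rcons.
  have Ci2 := nth_at eC2.
  have sC2 : size (c1' ++ compile p (size c1')) = size c1' + code_size p.
    by rewrite size_cat size_compile.
  case: ifP r1 OL => hP r1 OL.
    have [|||n [z2 [n2 r2]]] := IHp _ _ e O z1 used eC1 => //.
    have [z3] := run_sweep (O ++ out x p e) z2 Ci2 (work_zone_zone x e).
    rewrite if_same sweep_test szz /= sC2 => r3.
    exists ((2 * N).+1 + (n + (2 * N).+1)), z3; split.
      by rewrite !mulnDl; lia.
    apply: (steps_trans r1); apply: steps_trans _ r3.
    by move: r2; rewrite sc1'.
  have [|||n [z2 [n2 r2]]] := IHq _ _ e O z1 used eC3 => //.
  exists ((2 * N).+1 + n), z2; split.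
    by rewrite !mulnDl; lia.
  apply: (steps_trans r1); move: r2; rewrite sc3.
  by rewrite -addnA addSn -addSn !addSn.
Qed.

End LoopPrograms.

(** * Polynomial bounds and the running time of loop programs *)

Definition poly_bounded (g : nat -> nat) : Prop :=
  exists a d, forall n, g n <= poly_bound a d n.

Lemma poly_bounded_const c : poly_bounded (fun=> c).
Proof. by exists c, 0 => n; rewrite /poly_bound; lia. Qed.

Lemma poly_bounded_id : poly_bounded id.
Proof. by exists 1, 1 => n; rewrite /poly_bound expn1; lia. Qed.

(** The summand 1 covers [n = 0], where [0 ^ 0 = 1] may exceed [0 ^ d']. *)
Lemma leq_exp_add1 n d d' : d <= d' -> n ^ d <= n ^ d' + 1.
Proof.
case: n => [|n] dd; first by case: d dd => [|d] _; [rewrite leq_addl | rewrite {1}exp0n].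
by rewrite (leq_trans (leq_pexp2l _ dd)) // leq_addr.
Qed.

Lemma poly_boundedD g h :
  poly_bounded g -> poly_bounded h -> poly_bounded (fun n => g n + h n).
Proof.
move=> [a [d gP]] [b [e hP]]; exists (2 * (a + b)), (d + e) => n.
have := gP n; have := hP n; rewrite /poly_bound.
have := leq_mul (leqnn a) (leq_exp_add1 n (leq_addr e d)).
have := leq_mul (leqnn b) (leq_exp_add1 n (leq_addl d e)).
by nia.
Qed.

Lemma poly_boundedM g h :
  poly_bounded g -> poly_bounded h -> poly_bounded (fun n => g n * h n).
Proof.
(* The product expands into multiples of [n ^ (d + e)], [n ^ d], [n ^ e] and 1; the two middle
   powers are at most [n ^ (d + e) + 1], whence the factor 3. *)
move=> [a [d gP]] [b [e hP]]; exists (3 * (a * b)), (d + e) => n.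
apply: leq_trans (leq_mul (gP n) (hP n)) _; rewrite /poly_bound.
have -> : (a * n ^ d + a) * (b * n ^ e + b) = a * b * (n ^ (d + e) + n ^ d + n ^ e + 1).
  by rewrite expnD; lia.
have -> : 3 * (a * b) * n ^ (d + e) + 3 * (a * b) = a * b * (3 * n ^ (d + e) + 3) by lia.
rewrite leq_mul2l; apply/orP; right.
have := leq_exp_add1 n (leq_addr e d).
by have := leq_exp_add1 n (leq_addl d e); lia.
Qed.

Lemma eq_poly_bounded g h : g =1 h -> poly_bounded g -> poly_bounded h.
Proof. by move=> gh [a [d gP]]; exists a, d => n; rewrite -gh. Qed.

Lemma poly_bounded_cost (V : finType) (p : prog V) :
  poly_bounded (fun n => cost p (n + 2)).
Proof.
have n2 : poly_bounded (fun n => n + 2).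
  exact: poly_boundedD poly_bounded_id (poly_bounded_const 2).
elim: p => [s|p IHp q IHq|v p IHp|P p IHp q IHq] /=.
- exact: poly_bounded_const.
- exact: poly_boundedD.
- apply: poly_boundedD (poly_bounded_const 1) _; apply: poly_boundedM n2 _.
  by apply: eq_poly_bounded (poly_boundedD IHp (poly_bounded_const 1)) => n; rewrite addn1.
- exact: poly_boundedD (poly_bounded_const 2) (poly_boundedD IHp IHq).
Qed.

Theorem out_poly_time (V : finType) (p : prog V) :
  well_scoped [::] p -> poly_time_computable (fun x => out x p (idle_env V x)).
Proof.
move=> wp; pose C := IInit V :: compile p 1 ++ [:: IHalt V].
(* The summands count the initialization, the program, whose output is bounded by its own cost, and
   the final walk across the work zone. *)
pose T n := 2 * n + 3 + cost p (n + 2) * (2 * (n + 2 + cost p (n + 2)) + 1) + (n + 2).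
have [a [d TP]] : poly_bounded T.
  have n2 : poly_bounded (fun n => n + 2).
    exact: poly_boundedD poly_bounded_id (poly_bounded_const 2).
  have cp := poly_bounded_cost p; have c k := poly_bounded_const k.
  apply: (poly_boundedD _ n2).
  apply: (poly_boundedD (poly_boundedD (poly_boundedM (c 2) poly_bounded_id) (c 3)) _).
  by apply: poly_boundedM cp (poly_boundedD (poly_boundedM (c 2) (poly_boundedD n2 cp)) (c 1)).
exists (machine C), a, d; split.
  apply: machine_wf => //=.
  by rewrite size_cat size_compile addn1 /= all_cat compile_targets.
move=> x.
(* The initial zone carries no marks, which is the zone of the idle environment. *)
have zx : rcons (input_cells V true x) (false, None, [ffun=> false]) = zone x (idle_env V x).
  have cx k : k < zone_size x ->
      cell_at x (idle_env V x) k = (k == 0, onth x k, [ffun=> false]).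
    move=> kx; rewrite /cell_at; congr (_, _); apply/ffunP => v; rewrite !ffunE.
    by move: kx; case: eqP => // ->; rewrite ltnn.
  rewrite /zone.
  have /eq_in_map -> : {in iota 0 (zone_size x), cell_at x (idle_env V x)
      =1 fun k => (k == 0, onth x k, [ffun=> false])}.
    by move=> k; rewrite mem_iota => kx; apply: cx.
  have inp fst y : input_cells V fst y =
      [seq ((k == 0) && fst, onth y k, [ffun=> false]) | k <- iota 0 (size y).+1].
    elim: y fst => [//|b y IH] fst.
    have -> : iota 0 (size (b :: y)).+1 = 0 :: [seq 1 + i | i <- iota 0 (size y).+1].
      exact: (congr1 (cons 0) (iotaDl 1 0 (size y).+1)).
    rewrite [LHS]/= IH [RHS]map_cons -map_comp.
    by congr (_ :: _); apply: eq_map => k /=; rewrite andbF.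
  rewrite inp /zone_size addn2 -[(size x).+2]addn1 iotaD map_cat add0n.
  have on : onth x (size x).+1 = None by elim: (x).
  rewrite -{1}on -cats1; congr (_ ++ _).
  by congr (_ :: _); apply: eq_map => k; rewrite andbT.
have h1 := @run_init V C x erefl.
have [|//|v _|//|n [z [nT h2]]] := @run_compile V C [:: IInit V] [:: IHalt V] x p
  (idle_env V x) [::] 0 [::] (cost p (zone_size x)).
- by [].
- by rewrite ffunE.
- exact: size_out.
have [|c [h3 cN cO]] := @run_halt V C (1 + code_size p) (zone x (idle_env V x))
  (out x p (idle_env V x)) z.
  by rewrite /C /= nth_cat size_compile ltnn subnn.
exists (2 * size x + 3 + n + (size x + 2)), c; split; last split.
- apply: leq_trans (TP (size x)); rewrite /T /zone_size in nT *.
  by rewrite leq_add2r leq_add2l addn1.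
- move: h1; rewrite zx => h1.
  have := steps_trans (steps_trans h1 h2) h3.
  by rewrite size_map size_iota.
- by split.
Qed.

(** * Edit paths and the Hausdorff value *)

Section EditPaths.
Local Open Scope nat_scope.

Definition src (p : edit_path) : word := pmap id (map fst p).
Definition tgt (p : edit_path) : word := pmap id (map snd p).

Lemma src_split (p : edit_path) s1 s2 : src p = s1 ++ s2 ->
  exists p1 p2, [/\ p = p1 ++ p2, src p1 = s1 & src p2 = s2].
Proof.
elim: p s1 => [|[a b] p IH] s1.
  by case: s1 => //= h; exists [::], [::]; split.
case: s1 => [|c s1] /=; first by move=> h; exists [::], ((a, b) :: p); split.
case: a => [a|].
  by case=> <- /IH[p1 [p2 [-> <- <-]]]; exists ((Some a, b) :: p1), p2.
by move=> /(IH (c :: s1)) [p1 [p2 [-> h <-]]]; exists ((None, b) :: p1), p2.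
Qed.

Lemma wgt0_src_tgt (p : edit_path) : wgt p = 0 -> src p = tgt p.
Proof.
rewrite /src /tgt; elim: p => //= -[a b] p IH.
by rewrite /wgt /=; case: eqP => //= -> /IH ->.
Qed.

(** An operation that consumes no source letter is an insertion and has weight 1. *)
Lemma size_edit_path (p : edit_path) :
  all (fun ab : edit_op => (ab.1 != None) || (ab.2 != None)) p ->
  size p <= size (src p) + wgt p.
Proof.
rewrite /wgt /src; elim: p => //= -[a b] p IH /andP[ab /IH].
by case: a ab => [a|] /=; case: b => [b|] //=; lia.
Qed.

(** The part of the path that consumes one copy of [u] has positive weight: at weight 0 it would
    copy [u] into [y]. *)
Lemma wgt_blocks (u y : word) n (p : edit_path) :
  (forall s t, y <> s ++ u ++ t) -> src p = flatten (nseq n u) -> tgt p = y -> n <= wgt p.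
Proof.
elim: n y p => // n IH y p uy; rewrite /= => /src_split[p1 [p2 [-> p1u p2u]]] py.
have yE : y = tgt p1 ++ tgt p2 by rewrite -py /tgt map_cat pmap_cat.
have : n <= wgt p2.
  by apply: (IH (tgt p2)) => // s t e; apply: (uy (tgt p1 ++ s) t); rewrite yE e catA.
rewrite /wgt count_cat -!/(wgt _).
case E: (wgt p1) => [|w]; last by lia.
by case: (uy [::] (tgt p2)); rewrite /= -{1}p1u (wgt0_src_tgt E).
Qed.

End EditPaths.

Section AsymmetricHausdorff.
Import Order.TTheory GRing.Theory Num.Theory.
Local Open Scope classical_set_scope.
Local Open Scope ereal_scope.

Lemma ned_ge0 x y : 0 <= ned x y.
Proof.
rewrite /ned; case: ifP => // _; apply: le_ereal_inf_tmp => _ [p _ <-].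
by rewrite lee_fin divr_ge0 ?ler0n.
Qed.

Lemma ned_xx x : ned x x = 0.
Proof.
apply/eqP; rewrite eq_le ned_ge0 andbT /ned; case: ifP => // _.
apply: ereal_inf_lbound; exists [seq (Some a, Some a) | a <- x].
  by split; [elim: x | split; elim: x => //= a x ->].
suff -> : wgt [seq (Some a, Some a) | a <- x] = 0%N by rewrite mul0r.
by rewrite /wgt; elim: x => //= a x ->; rewrite eqxx.
Qed.

Definition tail_sup (X Y : set word) (m : nat) : \bar R :=
  ereal_sup [set ereal_inf [set ned x y | y in Y] | x in [set x | X x /\ (m <= size x)%N]].

Lemma is_cvg_tail_sup X Y : cvgn (tail_sup X Y).
Proof.
apply: ereal_nonincreasing_is_cvgn => m n mn.
apply: le_ereal_sup => _ [x [Xx nx] <-]; exists x => //.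
by split=> //; apply: leq_trans nx.
Qed.

Lemma AH_ned_subset (X Y : set word) : X `<=` Y -> AH_ned X Y <= 0.
Proof.
move=> XY; apply: lime_le; first exact: is_cvg_tail_sup.
apply: nearW => m; apply: ge_ereal_sup => _ [x [Xx _] <-].
by apply: ereal_inf_lbound; exists x; [exact: XY | exact: ned_xx].
Qed.

(** A path starting from [m.+1] copies of [u] has weight [w >= m.+1] and length at most
    [m.+1 * size u + w], so the ratio is at least [1 / (size u).+1], uniformly in [m]. *)
Lemma AH_ned_avoid (X Y : set word) (u : word) :
  u <> [::] -> (forall n, X (flatten (nseq n u))) ->
  (forall y s t, Y y -> y <> s ++ u ++ t) -> ~ (AH_ned X Y <= 0).
Proof.
move=> u0 Xu Yu.
have uS : (0 < size u)%N by case: (u) u0.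
pose c : R := ((size u).+1%:R^-1)%R.
have c0 : (0 < c)%R by rewrite invr_gt0 ltr0n.
have szb n : size (flatten (nseq n u)) = (n * size u)%N.
  by rewrite size_flatten /shape map_nseq sumn_nseq mulnC.
suff : c%:E <= AH_ned X Y by move=> cA /(le_trans cA); rewrite lee_fin leNgt c0.
apply: lime_ge; first exact: is_cvg_tail_sup.
apply: nearW => m; pose x := flatten (nseq m.+1 u).
apply: (@le_trans _ _ (ereal_inf [set ned x y | y in Y])); last first.
  by apply: ereal_sup_ubound; exists x => //; split; [exact: Xu | rewrite /x szb; nia].
apply: le_ereal_inf_tmp => _ [y Yy <-]; rewrite /ned.
have -> : (x == [::]) = false by rewrite -size_eq0 /x szb; apply/eqP; nia.
rewrite /=; apply: le_ereal_inf_tmp => _ [p [pok [px py]] <-].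
have wp : (m.+1 <= wgt p)%N by apply: (wgt_blocks (u := u) (y := y)) => // s t; apply: Yu.
have sp := size_edit_path pok; rewrite {1}/src px /x szb in sp.
have sp0 : (0 < size p)%N.
  by case: (p) wp => //; rewrite /wgt.
rewrite lee_fin /c ler_pdivlMr ?ltr0n // mulrC ler_pdivrMr ?ltr0n //.
by rewrite -natrM ler_nat; nia.
Qed.

End AsymmetricHausdorff.

(** * Encodings *)

Section Encodings.
Local Open Scope nat_scope.

(** Unique parsing in front of any rest: unlike injectivity, this passes to concatenations and
    lists. *)
Definition prefix_free (T : Type) (e : T -> seq bool) : Prop :=
  forall a b s t, e a ++ s = e b ++ t -> a = b /\ s = t.

Definition enc_bits (l : seq bool) : seq bool := flatten [seq [:: true; b] | b <- l] ++ [:: false].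

Lemma enc_bits_free : prefix_free enc_bits.
Proof.
rewrite /enc_bits => a b s t; elim: a b => [|x a IH] [|y b] //=; first by case.
by case=> -> /IH[-> ->].
Qed.

Fixpoint pos_bits (p : BinNums.positive) : seq bool :=
  match p with
  | BinNums.xH => [:: true]
  | BinNums.xO p' => rcons (pos_bits p') false
  | BinNums.xI p' => rcons (pos_bits p') true
  end.

Lemma enc_posE p : enc_pos p = flatten [seq [:: true; b] | b <- pos_bits p].
Proof. by elim: p => //= p ->; rewrite map_rcons flatten_rcons. Qed.

Definition pos_of_bits (l : seq bool) : BinNums.positive :=
  foldl (fun p (b : bool) => if b then BinNums.xI p else BinNums.xO p) BinNums.xH l.

Lemma pos_of_bitsK l : pos_bits (pos_of_bits l) = true :: l.
Proof.
by elim/last_ind: l => //= l b IH; rewrite /pos_of_bits foldl_rcons; case: b; rewrite /= IH.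
Qed.

Lemma pos_bitsK p : pos_of_bits (behead (pos_bits p)) = p /\ pos_bits p <> [::].
Proof.
elim: p => //= p [IH p0]; case: (pos_bits p) p0 IH => //= b l _ IH;
  by rewrite /pos_of_bits foldl_rcons -/(pos_of_bits _) IH.
Qed.

Lemma pos_bits_inj : injective pos_bits.
Proof. by move=> p q h; rewrite -(pos_bitsK p).1 h (pos_bitsK q).1. Qed.

(** The binary digits are 1 followed by [l]; the leading 1 keeps initial zeros of [l] significant,
    so every bit string can serve as a name. *)
Definition num_of_bits (l : seq bool) : nat := BinPos.Pos.to_nat (pos_of_bits l).

Lemma num_of_bits_inj : injective num_of_bits.
Proof.
move=> l l' /Pnat.Pos2Nat.inj h.
by have := pos_of_bitsK l; rewrite h pos_of_bitsK => -[].
Qed.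

Lemma enc_num_of_bits l : enc_nat (num_of_bits l) = enc_bits (true :: l).
Proof.
rewrite /enc_nat /num_of_bits (Nnat.N2Nat.id (BinNums.Npos (pos_of_bits l))).
by rewrite enc_posE pos_of_bitsK.
Qed.

Lemma num_of_bits_bounds l : 2 ^ size l <= num_of_bits l < 2 ^ (size l).+1.
Proof.
elim/last_ind: l => // l b; rewrite size_rcons /num_of_bits /pos_of_bits foldl_rcons.
rewrite -/(pos_of_bits l) !expnS => /andP[h1 h2].
case: b; rewrite ?Pnat.Pos2Nat.inj_xI ?Pnat.Pos2Nat.inj_xO -?multE; move: h1 h2.
  by move: (BinPos.Pos.to_nat _) (2 ^ _) => u v; lia.
by move: (BinPos.Pos.to_nat _) (2 ^ _) => u v; lia.
Qed.

Lemma num_of_bits_lt l m : size l < m -> num_of_bits l < num_of_bits (nseq m false).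
Proof.
move=> lm; have /andP[_ h] := num_of_bits_bounds l.
have /andP[h' _] := num_of_bits_bounds (nseq m false).
by apply: leq_trans h (leq_trans _ h'); rewrite size_nseq leq_exp2l.
Qed.

Lemma enc_nat_free : prefix_free enc_nat.
Proof.
have encE n : enc_nat n =
    enc_bits (if BinNat.N.of_nat n is BinNums.Npos p then pos_bits p else [::]).
  by rewrite /enc_nat; case: (BinNat.N.of_nat n) => //= p; rewrite enc_posE.
move=> a b s t; rewrite !encE => /enc_bits_free[h ->]; split=> //.
apply: Nnat.Nat2N.inj; move: h.
case: (BinNat.N.of_nat a) => [|p]; case: (BinNat.N.of_nat b) => [|q] //.
- by move=> h; case: (pos_bitsK q) => _ /(_ (esym h)).
- by move=> h; case: (pos_bitsK p) => _ /(_ h).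
- by move/pos_bits_inj => ->.
Qed.

Lemma enc_list_free (T : Type) (e : T -> seq bool) : prefix_free e -> prefix_free (enc_list e).
Proof.
rewrite /enc_list => ef a b s t; elim: a b => [|x a IH] [|y b] //=; first by case.
by case; rewrite -!catA => /ef[->]; rewrite !catA => /IH[-> ->].
Qed.

Lemma enc_int_free : prefix_free enc_int.
Proof. by case=> a [] b s t //= [] /enc_nat_free[-> ->]. Qed.

Lemma enc_rat_free : prefix_free enc_rat.
Proof.
move=> a b s t; rewrite /enc_rat -!catA => /enc_int_free[nab /enc_int_free[dab ->]].
by split=> //; rewrite -(divq_num_den a) nab dab divq_num_den.
Qed.

Lemma enc_triple_free : prefix_free enc_triple.
Proof.
move=> [[a1 a2] a3] [[b1 b2] b3] s t; rewrite /enc_triple /= -!catA.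
by move=> /enc_nat_free[-> /enc_nat_free[-> /enc_nat_free[-> ->]]].
Qed.

Lemma prefix_free_cat (T A B : Type) (e : T -> seq bool) (f : A -> seq bool) (g : B -> seq bool)
    (p : T -> A) (q : T -> B) :
  (forall a, e a = f (p a) ++ g (q a)) -> (forall a b, p a = p b -> q a = q b -> a = b) ->
  prefix_free f -> prefix_free g -> prefix_free e.
Proof.
move=> eE pq ff gf a b s t; rewrite !eE -!catA => /ff[pab /gf[qab ->]].
by split=> //; apply: pq.
Qed.

(** [AH_language] speaks of some instance with the given code; injectivity says which one it is. *)
Lemma enc_instance_inj : injective enc_instance.
Proof.
have nfaf : prefix_free enc_nfa.
  apply: (@prefix_free_cat _ _ (seq (nat * nat * nat) * (seq nat * seq nat)) _ enc_nat
    (fun u => enc_list enc_triple u.1 ++ enc_list enc_nat u.2.1 ++ enc_list enc_nat u.2.2)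
    nfa_nstates (fun T => (nfa_trans T, (nfa_init T, nfa_final T)))) => //.
  - by move=> [n tr ini fin] [n' tr' ini' fin'] /= -> [-> -> ->].
  - exact: enc_nat_free.
  apply: (@prefix_free_cat _ _ (seq nat * seq nat) _ (enc_list enc_triple)
    (fun u => enc_list enc_nat u.1 ++ enc_list enc_nat u.2) fst snd) => //.
  - by move=> [a b] [c d] /= -> ->.
  - exact: enc_list_free enc_triple_free.
  apply: (@prefix_free_cat _ _ _ _ (enc_list enc_nat) (enc_list enc_nat) fst snd) => //.
  - by move=> [a b] [c d] /= -> ->.
  - exact: enc_list_free enc_nat_free.
  - exact: enc_list_free enc_nat_free.
suff h : prefix_free enc_instance.
  by move=> I J /(congr1 (cat^~ [::])) /h[].
apply: (@prefix_free_cat _ _ (nfa * rat) _ enc_nat (fun u => enc_nfa u.1 ++ enc_rat u.2)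
  inst_k (fun I => (inst_T I, inst_nu I))) => //.
- by move=> [k T nu] [k' T' nu'] /= -> [-> ->].
- exact: enc_nat_free.
apply: (@prefix_free_cat _ _ _ _ enc_nfa enc_rat fst snd) => //.
- by move=> [a b] [c d] /= -> ->.
- exact: enc_rat_free.
Qed.

End Encodings.

(** * Computation histories *)

Section Histories.

Variable M : TM.
Hypothesis M_wf : tm_wf M.

(* A tape cell, with the state if the head is there; [None] precedes each configuration. *)
Definition letter := option ('I_(tm_syms M).+1 * option 'I_(tm_states M).+1).

Definition tape_of (c : config) : seq nat := rev (cf_left c) ++ cf_head c :: cf_right c.

(** The default 0 of [nth] pads the tape with blanks, so that configurations can be cut at a common
    length. *)
Definition config_letter (c : config) (k : nat) : letter :=
  if k is k'.+1 then
    Some (inord (nth 0 (tape_of c) k'),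
          if k' == size (cf_left c) then Some (inord (cf_state c)) else None)
  else None.

Definition arriving (right : bool) (a : letter) : option 'I_(tm_states M).+1 :=
  if a is Some (s, Some q) then
    if tm_delta M q s is Some (q', _, d) then if d == right then Some (inord q') else None
    else None
  else None.

(** The local rule of the machine. A head on the first cell, recognized by the separator to its
    left, stays there on a left move; the letter of a halted head is repeated. *)
Definition next_letter (l c r : letter) : letter :=
  match c with
  | None => None
  | Some (s, Some q) =>
      if tm_delta M q s is Some (q', b, d) then
        Some (inord b, if ~~ d && (l == None) then Some (inord q') else None)
      else c
  | Some (s, None) =>
      Some (s, if arriving true l is Some q then Some q else arriving false r)
  end.

Definition in_range (c : config) : Prop :=
  cf_state c < tm_states M /\ all (fun a => a < tm_syms M) (tape_of c).

(** A halted configuration is its own successor, which makes histories infinite. *)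
Definition next_config (c : config) : config := odflt c (tm_step M c).

Lemma step_spec c q' b d : tm_delta M (cf_state c) (cf_head c) = Some (q', b, d) ->
  let c' := next_config c in
  [/\ cf_state c' = q',
      size (cf_left c') = (if d then (size (cf_left c)).+1 else (size (cf_left c)).-1)
    & forall k, nth 0 (tape_of c') k = if k == size (cf_left c) then b else nth 0 (tape_of c) k].
Proof.
have upd (l r : seq nat) h k : nth 0 (rev l ++ b :: r) k =
    if k == size l then b else nth 0 (rev l ++ h :: r) k.
  rewrite !nth_cat size_rev; case: ltngtP => //= [|->]; last by rewrite subnn.
  by move=> lk; case E: (k - size l) => [|j] //; lia.
case: c => q l h r /= dE; rewrite /next_config /tm_step /= dE; case: d {dE}.
  case: r => [|r0 r]; split=> //= k; rewrite /tape_of /= rev_cons cat_rcons //.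
  (* Moving beyond the right end appends a blank, which [nth] with default 0 does not see. *)
  rewrite -(upd l [::] h k) -[b :: [:: 0]]/([:: b] ++ [:: 0]) catA nth_cat.
  by case: ltnP => // /(nth_default 0) ->; case: (_ - _) => // -[].
case: l => [|l0 l] /=; split=> //= k; rewrite /tape_of /=.
  exact: (upd [::] r h k).
by have := upd (l0 :: l) r h k; rewrite rev_cons !cat_rcons.
Qed.

Lemma nth_tape_head c : nth 0 (tape_of c) (size (cf_left c)) = cf_head c.
Proof. by rewrite /tape_of nth_cat size_rev ltnn subnn. Qed.

Lemma nth_tape_lt c k : in_range c -> nth 0 (tape_of c) k < tm_syms M.
Proof.
case=> _ /allP h; case: (ltnP k (size (tape_of c))) => kc.
  exact: h (mem_nth 0 kc).
by rewrite nth_default //; case: M_wf; lia.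
Qed.

Lemma in_range_next c : in_range c -> in_range (next_config c).
Proof.
move=> rc; have := nth_tape_lt _ rc; move: rc => [qc _] tc.
case: M_wf => _ [_ [_ /(_ _ _ qc (tc (size (cf_left c))))]]; rewrite nth_tape_head.
case dE: (tm_delta _ _ _) => [[[q' b] d]|]; last first.
  move=> _; rewrite /next_config /tm_step dE; split=> //.
  by apply/(all_nthP 0) => i _; apply: tc.
case=> q'lt blt; have [e1 _ e3] := step_spec dE; split; first by rewrite e1.
by apply/(all_nthP 0) => i _; rewrite e3; case: ifP.
Qed.

Lemma config_letter_next c k : in_range c ->
  config_letter (next_config c) k.+1 =
  next_letter (config_letter c k) (config_letter c k.+1) (config_letter c k.+2).
Proof.
move=> rc; have tlt := nth_tape_lt _ rc.
have inK j : (inord (nth 0 (tape_of c) j) : 'I_(tm_syms M).+1) = nth 0 (tape_of c) j :> nat.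
  by rewrite inordK // ltnS ltnW.
have inQ : (inord (cf_state c) : 'I_(tm_states M).+1) = cf_state c :> nat.
  by rewrite inordK // ltnS ltnW //; case: rc.
have arrE right j : arriving right (config_letter c j.+1) =
    if j == size (cf_left c) then
      if tm_delta M (cf_state c) (cf_head c) is Some (q', _, d)
      then if d == right then Some (inord q') else None else None
    else None.
  by rewrite /=; case: eqP => // ->; rewrite inK inQ nth_tape_head.
have := arrE false k.+1; move: (config_letter c k.+2) => r rE.
rewrite {2}/config_letter /next_letter.
case dE: (tm_delta M (cf_state c) (cf_head c)) => [[[q' b] d]|]; last first.
  have -> : next_config c = c by rewrite /next_config /tm_step dE.
  rewrite /=; case: eqP => [->|_]; first by rewrite inK inQ nth_tape_head dE.
  rewrite rE dE !if_same.
  by case: (k) => [|j] //; rewrite arrE dE !if_same.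
have [e1 e2 e3] := step_spec dE.
rewrite [LHS]/= e1 e2 e3; set p := size (cf_left c).
case: (altP (k =P p)) => [->|kp].
  rewrite inK inQ nth_tape_head dE; congr (Some (_, _)); case: d {dE e2} => /=.
    by rewrite ltn_eqF.
  by case: p => [|p] //=; rewrite gtn_eqF.
congr (Some (_, _)); rewrite rE dE -/p.
have -> : arriving true (config_letter c k) =
    if (k == p.+1) && d then Some (inord q') else None.
  case: (k) => [|j] //; rewrite arrE dE -/p eqSS; case: eqP => //=; by case: (d).
case: d {dE e2} => /=; first by rewrite andbT if_same; case: ifP.
rewrite andbF; congr (if _ then _ else _).
by clear rE; case: p kp => [|p] kp; [lia | rewrite eqSS].
Qed.

Variable x : seq bool.
Variable K : nat.
Hypothesis K_space : forall n c, tm_cfg M x n = Some c -> cf_space c <= K.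

Definition conf (m : nat) : config := iter m next_config (tm_init M x).

Lemma confS m : conf m.+1 = next_config (conf m).
Proof. by []. Qed.

Lemma tm_cfgS n : tm_cfg M x n.+1 = obind (tm_step M) (tm_cfg M x n).
Proof. by []. Qed.

Lemma tm_cfg_conf n c : tm_cfg M x n = Some c -> conf n = c.
Proof.
elim: n c => [|n IH] c; first by case.
rewrite tm_cfgS; case E: (tm_cfg M x n) => [c'|] //= st.
by rewrite (IH _ E) /next_config st.
Qed.

Lemma conf_tm_cfg m : exists n, tm_cfg M x n = Some (conf m).
Proof.
elim: m => [|m [n IH]]; first by exists 0.
rewrite confS /next_config.
case E: (tm_step M (conf m)) => [c|]; last by exists n.
by exists n.+1; rewrite tm_cfgS IH.
Qed.

Lemma in_range_init : in_range (tm_init M x).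
Proof.
case: M_wf => s3 [sq _]; rewrite /in_range /tm_init /tape_of.
case: x => [|b y] /=; split => //; first by rewrite andbT; lia.
rewrite all_map; apply/andP; split; first by case: b; rewrite /=; lia.
by apply/allP => -[] _ /=; lia.
Qed.

Lemma in_range_conf m : in_range (conf m).
Proof. by elim: m => [|m IH]; [exact: in_range_init | exact: in_range_next]. Qed.

Lemma conf_space m : cf_space (conf m) <= K.
Proof. by have [n /K_space] := conf_tm_cfg m. Qed.

Lemma conf_halted m j : tm_step M (conf m) = None -> conf (m + j) = conf m.
Proof.
move=> h; elim: j => [|j IH]; first by rewrite addn0.
by rewrite addnS confS IH /next_config h.
Qed.

(** The infinite word of all configurations, each written as a separator and [K] cells. *)
Definition history (p : nat) : letter := config_letter (conf (p %/ K.+1)) (p %% K.+1).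

Lemma history_at m k : k <= K -> history (m * K.+1 + k) = config_letter (conf m) k.
Proof. by move=> kK; rewrite /history divnMDl // modnMDl divn_small ?modn_small ?addn0. Qed.

Lemma history_next i :
  history (i.+1 + K.+1) = next_letter (history i) (history i.+1) (history i.+2).
Proof.
have [m [k [kK e]]] : exists m k, k <= K /\ i.+1 = m * K.+1 + k.
  by exists (i.+1 %/ K.+1), (i.+1 %% K.+1); rewrite -divn_eq -ltnS ltn_pmod.
have hS j : j <= K -> history (m * K.+1 + j + K.+1) = config_letter (conf m.+1) j.
  by move=> jK; rewrite addnAC -mulSnr history_at.
rewrite e; case: k kK e => [|k] kK e.
  by rewrite hS // history_at.
have -> : i = m * K.+1 + k by lia.
rewrite hS // -addnS [history (_ + k)]history_at ?(ltnW kK) // [history (_ + k.+1)]history_at //.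
rewrite confS config_letter_next; last exact: in_range_conf.
case: (ltnP k.+1 K) => kK'; first by rewrite history_at.
(* At the last cell the right neighbour in the history is the next separator, not a tape cell. The
   rule gives the same letter, as the space bound keeps the head off cell [K.+1] and nothing can
   arrive from there. *)
have -> : k.+2 = K.+1 by lia.
rewrite -mulSnr -[m.+1 * _]addn0 history_at // /next_letter.
case: (config_letter (conf m) k.+1) => [[s [q|]]|] //.
have := conf_space m; rewrite /cf_space => sp.
rewrite /=; have -> : (K == size (cf_left (conf m))) = false by apply/eqP; lia.
by [].
Qed.

Definition rejecting (a : letter) : bool :=
  if a is Some (s, Some q) then (val q != tm_accept M) && (tm_delta M q s == None) else false.

Lemma rejecting_config_letter m k :
  rejecting (config_letter (conf m) k) ->
  tm_step M (conf m) = None /\ cf_state (conf m) != tm_accept M.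
Proof.
have rm := in_range_conf m; case: k => // k /=; case: eqP => // -> /andP[].
rewrite /= nth_tape_head !inordK; last 2 first.
- by rewrite -nth_tape_head ltnS ltnW // nth_tape_lt.
- by rewrite ltnS ltnW //; case: rm.
by move=> qa /eqP dN; rewrite /tm_step dN.
Qed.

(** There is only one halted configuration: halted configurations after [m] and after [n] steps both
    equal the one after [m + n] steps. *)
Lemma rejecting_historyP n c (P : Prop) :
  tm_cfg M x n = Some c -> tm_step M c = None -> (cf_state c = tm_accept M <-> P) ->
  (exists p, rejecting (history p)) <-> ~ P.
Proof.
move=> /tm_cfg_conf nc cN <-; split.
  case=> p /rejecting_config_letter; set m := p %/ _ => -[mN ma] ca.
  have := conf_halted m (etrans (congr1 _ nc) cN); rewrite addnC conf_halted // nc => e.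
  by rewrite e ca eqxx in ma.
move=> ca; exists (n * K.+1 + (size (cf_left c)).+1).
have rc := in_range_conf n; rewrite nc in rc.
rewrite history_at; last by have := conf_space n; rewrite nc /cf_space; lia.
rewrite nc /= eqxx nth_tape_head /= !inordK; last 2 first.
- by rewrite -nth_tape_head ltnS ltnW // nth_tape_lt.
- by rewrite ltnS ltnW //; case: rc.
by move: cN; rewrite /tm_step; case: (tm_delta _ _ _) => [[[q' b] []]|] /=;
  [case: (cf_right c) | case: (cf_left c) | rewrite andbT => _; apply/eqP].
Qed.

(* The negation says that [w] is a prefix of the history that contains a rejecting letter. *)
Definition flawed (w : seq letter) : Prop :=
  [\/ ~~ has rejecting w,
      exists2 k, k < size w & k <= K.+1 /\ nth None w k != history k
    | exists2 i, i.+1 + K.+1 < size w &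
        nth None w (i.+1 + K.+1) !=
        next_letter (nth None w i) (nth None w i.+1) (nth None w i.+2)].

(** The first [K.+2] letters are checked directly. They include the second separator, at [K.+1],
    which the successor rule cannot reach because the first separator has no left neighbour; the
    rule determines all later letters. *)
Lemma not_flawed_prefix w : ~ flawed w -> forall p, p < size w -> nth None w p = history p.
Proof.
(* Positivity of [K] ensures that [i.+2] is below [p = i.+1 + K.+1]. *)
have K1 : 0 < K by have := conf_space 0; rewrite /cf_space; lia.
move=> nf; elim/ltn_ind => p IH pw.
case: (leqP p K.+1) => pK.
  by apply/eqP; apply/negP => /negP ne; apply: nf; apply: Or32; exists p.
have [i ei] : exists i, p = i.+1 + K.+1 by exists (p - K.+2); lia.
have -> : nth None w p = next_letter (nth None w i) (nth None w i.+1) (nth None w i.+2).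
  by apply/eqP; apply/negP => /negP ne; apply: nf; apply: Or33; exists i; rewrite -ei.
by rewrite {1}ei history_next; congr next_letter; apply: IH; lia.
Qed.

Lemma not_flawedP : (exists w, ~ flawed w) <-> (exists p, rejecting (history p)).
Proof.
split=> [[w nf]|[p rp]].
  have /(has_nthP None)[p pw] : has rejecting w.
    by apply/negPn/negP => h; apply: nf; apply: Or31.
  by rewrite not_flawed_prefix // => rp; exists p.
have hn k : k <= p -> nth None (mkseq history p.+1) k = history k by move=> kp; rewrite nth_mkseq.
exists (mkseq history p.+1); case=> [/hasP[]|[k]|[i]].
- by exists (history p) => //; apply/mapP; exists p; rewrite ?mem_iota //=; lia.
- by rewrite size_mkseq ltnS => kp [_]; rewrite hn // eqxx.
- by rewrite size_mkseq ltnS => ip; rewrite !hn ?history_next ?eqxx //; lia.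
Qed.

End Histories.

(** * The automaton of flawed blocks *)

Section BlockAutomaton.

Variable D : finType.
Variables (sep : D) (rej : pred D) (next : D -> D -> D -> D) (ini : nat -> D) (J : nat).

(* An accepting run certifies a flaw in every block between separators [None]:
   no rejecting letter ([sNo]), a wrong letter among the first [J.+3] ones
   ([sC None] and [sY] count the position), or a wrong successor ([sA], [sB] store the
   neighbourhood and [sC (Some v)] counts the distance to the letter that should be [v]). *)
Inductive state :=
  | sNo | sGood | sWait
  | sY of bool
  | sA of D
  | sB of D & D
  | sC of option D & nat.

(** All chains [sC v] end at [J], the number of letters between a neighbourhood and its successor.
    Initial letters are checked up to position [J.+2], and the states [sY] count the two extra
    positions. *)
Definition edge (s : state) (l : option D) (t : state) : bool :=
  match l, s, t with
  | None, (sNo | sGood), (sNo | sWait | sC None 0) => true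
  | Some a, sNo, sNo => ~~ rej a
  | Some _, sGood, sGood => true
  | Some _, sWait, sWait => true
  | Some a, sWait, sA b => a == b
  | Some b, sA a, sB a' b' => (a == a') && (b == b')
  | Some c, sB a b, sC (Some v) 0 => v == next a b c
  | Some _, sC v j, sC w k => [&& v == w, k == j.+1 & j < J]
  | Some a, sC None j, sGood => (j <= J) && (a != ini j)
  | Some a, sC (Some v) j, sGood => (j == J) && (a != v)
  | Some _, sC None j, sY false => j == J
  | Some _, sY false, sY true => true
  | Some a, sY b, sGood => a != ini (J + b).+1
  | _, _, _ => false
  end.

Definition is_start (s : state) : bool :=
  match s with sNo | sWait | sC None 0 => true | _ => false end.

Definition is_final (s : state) : bool :=
  match s with sNo | sGood => true | _ => false end.

Lemma edge_sep s t : edge s None t = is_final s && is_start t.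
Proof. by case: s => [|||b|a|a b|v j]; case: t => [|||b'|a'|a' b'|[w|] [|k]]. Qed.

Fixpoint run (s : state) (w : seq (option D)) (t : state) : Prop :=
  if w is l :: w' then exists2 r, edge s l r & run r w' t else s = t.

Lemma run_cat s w1 w2 t : run s (w1 ++ w2) t <-> exists2 r, run s w1 r & run r w2 t.
Proof.
elim: w1 s => [|l w1 IH] s /=; first by split=> [h|[r -> //]]; exists s.
split=> [[r sr /IH[r' h h']]|[r' [r sr h] h']].
  by exists r' => //; exists r.
by exists r => //; apply/IH; exists r'.
Qed.

Lemma run_rcons s w l t : run s (rcons w l) t <-> exists2 r, run s w r & edge r l t.
Proof.
rewrite -cats1; split=> [/run_cat[r h [r' e <-]]|[r h e]]; first by exists r.
by apply/run_cat; exists r => //; exists t.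
Qed.

(** The last two cases of [flawed], with [J.+1] for [K]. *)
Definition bad (w : seq D) : Prop :=
  (exists2 k, k < size w & k <= J.+2 /\ nth sep w k != ini k) \/
  (exists2 i, i.+1 + J.+2 < size w &
     nth sep w (i.+1 + J.+2) != next (nth sep w i) (nth sep w i.+1) (nth sep w i.+2)).

Lemma bad_rcons w a : bad w -> bad (rcons w a).
Proof.
case=> [[k kw [kJ ne]]|[i iw ne]]; [left; exists k|right; exists i]; rewrite ?size_rcons.
- exact: ltnW.
- by rewrite nth_rcons kw.
- exact: ltnW.
- by rewrite !nth_rcons iw !ifT //; lia.
Qed.

(** The invariant of runs inside a block: what being in [t] reveals about the part [w] of the block
    read so far. *)
Definition reads (t : state) (w : seq D) : Prop :=
  match t with
  | sNo => ~~ has rej w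
  | sGood => bad w
  | sWait => True
  | sY b => size w = (J + b).+1
  | sA a => exists z, w = z ++ [:: a]
  | sB a b => exists z, w = z ++ [:: a; b]
  | sC None j => size w = j
  | sC (Some v) j => exists z a b c y,
      [/\ w = z ++ [:: a, b, c & y], v = next a b c & size y = j]
  end.

Lemma reads_edge s w a t : reads s w -> edge s (Some a) t -> reads t (rcons w a).
Proof.
have badP k : size w = k -> k <= J.+2 -> a != ini k -> bad (rcons w a).
  move=> sw kJ ne; left; exists k; first by rewrite size_rcons sw.
  by rewrite nth_rcons sw ltnn eqxx.
case: s => [|||[]|b|b c|[v|] j]; case: t => [|||[]|b'|b' c'|[v'|] j'] //=.
- by rewrite has_rcons => /negbTE ->; rewrite orbF.
- by move=> h _; apply: bad_rcons.
- by move=> _ /eqP <-; exists w; rewrite cats1.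
- by move/badP; apply; lia.
- by move/badP; apply; lia.
- by move=> sw _; rewrite size_rcons sw addn0 addn1.
- by case=> z -> /andP[/eqP <- /eqP <-]; exists z; rewrite -cats1 -catA.
- case: j' => // -[z ->] /eqP ->; exists z, b, c, a, [::]; split=> //.
  by rewrite -cats1 -catA.
- case=> z [b [c [d [y [-> -> sy]]]]] /andP[/eqP jJ ne]; right; exists (size z).
    by rewrite size_rcons size_cat /= sy; lia.
  have nz k : nth sep (rcons (z ++ [:: b, c, d & y]) a) (size z + k) =
      nth sep [:: b, c, d & rcons y a] k.
    by rewrite -cats1 -catA nth_cat ltnNge leq_addr addKn /= cats1.
  have -> : (size z).+1 + J.+2 = size z + J.+3 by lia.
  have := (nz 0, nz 1, nz 2); rewrite addn0 addn1 addn2 => -[[-> ->] ->].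
  by rewrite nz /= nth_rcons sy jJ ltnn eqxx.
- case=> z [b [c [d [y [-> -> sy]]]]] /and3P[/eqP[<-] /eqP -> _].
  by exists z, b, c, d, (rcons y a); rewrite size_rcons sy -!cats1 -catA.
- by move=> sw /andP[jJ ne]; apply: badP sw _ ne; lia.
- by move=> sw /eqP jJ; rewrite size_rcons sw jJ addn0.
- by move=> sw /andP[/eqP -> _]; rewrite size_rcons sw.
Qed.

Lemma run_reads s w t : is_start s -> run s (map some w) t -> reads t w.
Proof.
move=> ss; elim/last_ind: w t => [t <-|w a IH t].
  by case: s ss => // -[] // [].
by rewrite map_rcons => /run_rcons[r /IH h e]; apply: reads_edge e.
Qed.

Definition flawed_block (w : seq D) : Prop := ~~ has rej w \/ bad w.

Lemma run_flawed s w t : is_start s -> is_final t -> run s (map some w) t -> flawed_block w.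
Proof. by move=> ss ft /(run_reads ss); case: t ft => // _ h; [left | right]. Qed.

Lemma run_loop s w : (forall a, a \in w -> edge s (Some a) s) -> run s (map some w) s.
Proof.
elim: w => //= a w IH h; exists s; first by apply: h; rewrite inE eqxx.
by apply: IH => b bw; apply: h; rewrite inE bw orbT.
Qed.

Lemma run_chain v w j : j + size w <= J -> run (sC v j) (map some w) (sC v (j + size w)).
Proof.
elim: w j => [|a w IH] j /=; first by rewrite addn0.
move=> jJ; exists (sC v j.+1); first by case: (v) => [v'|] /=; rewrite !eqxx /=; lia.
by rewrite addnS -addSn; apply: IH; lia.
Qed.

Definition counter (k : nat) : state := if k <= J then sC None k else sY (k == J.+2).

Lemma run_counter w : size w <= J.+2 -> run (sC None 0) (map some w) (counter (size w)).
Proof.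
elim/last_ind: w => // w a IH; rewrite size_rcons map_rcons => wJ.
apply/run_rcons; exists (counter (size w)); first by apply: IH; lia.
rewrite /counter; case: (ltngtP (size w) J) => [h|h|->].
- by rewrite /= eqxx.
- rewrite /=; have -> : (size w == J.+2) = false by apply/eqP; lia.
  have -> : size w = J.+1 by lia.
  by rewrite eqxx.
- rewrite /= eqxx; have -> : (J.+1 == J.+2) = false by apply/eqP; lia.
  by [].
Qed.

Lemma flawed_run w : flawed_block w ->
  exists s t, [/\ is_start s, is_final t & run s (map some w) t].
Proof.
case=> [nr|[[k kw [kJ ne]]|[i iw ne]]].
- exists sNo, sNo; split=> //; apply: run_loop => a aw /=.
  by apply: contra nr => ra; apply/hasP; exists a.
- exists (sC None 0), sGood; split=> //.
  rewrite -(cat_take_drop k w) map_cat; apply/run_cat; exists (counter k).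
    have := @run_counter (take k w); rewrite size_take kw; exact.
  rewrite (drop_nth sep kw) /=; exists sGood; last exact: run_loop.
  rewrite /counter; case: leqP => [kJ'|Jk] /=; first by rewrite kJ'.
  case: (altP (k =P J.+2)) ne => [->|/eqP kn] /= ne; first by rewrite addn1.
  by rewrite addn0; have <- : k = J.+1 by lia.
exists sWait, sGood; split=> //.
have i0 : i < size w by lia.
have i1 : i.+1 < size w by lia.
have i2 : i.+2 < size w by lia.
rewrite -(cat_take_drop i w) map_cat; apply/run_cat; exists sWait; first exact: run_loop.
rewrite (drop_nth sep i0) (drop_nth sep i1) (drop_nth sep i2) /=.
set a := nth sep w i; set b := nth sep w i.+1; set c := nth sep w i.+2.
exists (sA a) => /=; first exact: eqxx.
exists (sB a b) => /=; first by rewrite !eqxx.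
exists (sC (Some (next a b c)) 0) => /=; first exact: eqxx.
rewrite -(cat_take_drop J (drop _ _)) map_cat; apply/run_cat.
exists (sC (Some (next a b c)) J).
  have := @run_chain (Some (next a b c)) (take J (drop i.+3 w)) 0.
  rewrite add0n size_take size_drop ifT; last by lia.
  by apply.
rewrite drop_drop; have -> : J + i.+3 = i.+1 + J.+2 by lia.
rewrite (drop_nth sep iw) /=; exists sGood; last exact: run_loop.
by rewrite eqxx.
Qed.

Lemma split_sep (w : seq (option D)) :
  (exists u, w = map some u) \/ (exists u w', w = map some u ++ None :: w').
Proof.
elim: w => [|[a|] w [[u ->]|[u [w' ->]]]]; first by left; exists [::].
- by left; exists (a :: u).
- by right; exists (a :: u), w'.
- by right; exists [::], (map some u).
- by right; exists [::], (map some u ++ None :: w').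
Qed.

(** On a separator every final state has an edge to every start state, so the runs for the single
    blocks can be joined. *)
Lemma flawed_run_all : (forall u, flawed_block u) ->
  forall w, exists s t, [/\ is_start s, is_final t & run s w t].
Proof.
move=> fl w; have [n] := ubnP (size w); elim: n w => // n IH w wn.
case: (split_sep w) => [[u ->]|[u [w' ew]]]; first exact: flawed_run.
have [|s' [t' [ss' ft' r']]] := IH w'.
  by move: wn; rewrite ew size_cat /=; lia.
have [s [t [ss ft r]]] := flawed_run (fl u).
exists s, t'; split=> //; rewrite ew; apply/run_cat; exists t => //.
by exists s' => //; rewrite edge_sep ft ss'.
Qed.

Lemma run_block s w1 u w2 t :
  run s (w1 ++ None :: map some u ++ None :: w2) t -> flawed_block u.
Proof.
case/run_cat => r _ [r1]; rewrite edge_sep => /andP[_ s1] /run_cat[r2 h [r3]].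
by rewrite edge_sep => /andP[f2 _] _; apply: run_flawed s1 f2 h.
Qed.

End BlockAutomaton.

(** * Programs that print the automaton *)

Section ProgramCombinators.

Variable V : finType.

Lemma well_scoped_sub (u u' : seq V) p :
  {subset u <= u'} -> well_scoped u' p -> well_scoped u p.
Proof.
elim: p u u' => [s|p IHp q IHq|v p IHp|P p IHp q IHq] u u' uu' //=.
- by case/andP=> /(IHp _ _ uu') -> /(IHq _ _ uu').
- case/andP=> vu' wp; rewrite (contra (uu' v)) //=; apply: IHp wp => w.
  by rewrite !inE => /orP[->//|/uu' ->]; rewrite orbT.
- by case/andP=> /(IHp _ _ uu') -> /(IHq _ _ uu').
Qed.

Definition pseqs (ps : seq (prog V)) : prog V := foldr (@PSeq V) (PEmit V [::]) ps.

Lemma out_pseqs x ps e : out x (pseqs ps) e = flatten [seq out x p e | p <- ps].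
Proof. by elim: ps => //= p ps ->. Qed.

Lemma well_scoped_pseqs u ps : well_scoped u (pseqs ps) = all (well_scoped u) ps.
Proof. by elim: ps => //= p ps ->. Qed.

Definition pfors (vs : seq V) (p : prog V) : prog V := foldr (@PFor V) p vs.

Fixpoint envs (x : seq bool) (vs : seq V) (e : env V) : seq (env V) :=
  if vs is v :: vs' then flatten [seq envs x vs' (upd e v k) | k <- iota 0 (zone_size x)]
  else [:: e].

Lemma flatten_flatten_map (T S : Type) (f : T -> seq S) (ss : seq (seq T)) :
  flatten [seq f y | y <- flatten ss] = flatten [seq flatten (map f s) | s <- ss].
Proof. by elim: ss => //= s ss IH; rewrite map_cat flatten_cat IH. Qed.

Lemma out_pfors x vs p e : out x (pfors vs p) e = flatten [seq out x p e' | e' <- envs x vs e].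
Proof.
elim: vs e => [|v vs IH] e /=; first by rewrite cats0.
rewrite flatten_flatten_map -map_comp; congr flatten.
by apply: eq_map => k /=; rewrite IH.
Qed.

Lemma well_scoped_pfors u vs p :
  uniq vs -> ~~ has (mem u) vs -> well_scoped (vs ++ u) p -> well_scoped u (pfors vs p).
Proof.
elim: vs u => [//|v vs IH] u /= /andP[vvs uvs]; rewrite negb_or => /andP[vu hvs] wp.
rewrite vu IH //.
  apply: contra hvs => /hasP[w wvs]; rewrite inE => /orP[/eqP e|wu].
    by move: vvs; rewrite -e wvs.
  by apply/hasP; exists w.
by apply: well_scoped_sub wp => w; rewrite !(inE, mem_cat) /= orbCA.
Qed.

Lemma envs_notin x vs e e' v : e' \in envs x vs e -> v \notin vs -> e' v = e v.
Proof.
elim: vs e => [|w vs IH] e /=; first by rewrite inE => /eqP ->.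
case/flattenP => _ /mapP[k _ ->] /IH h; rewrite inE negb_or => /andP[vw /h ->].
by rewrite ffunE (negbTE vw).
Qed.

Lemma size_envs x vs e : size (envs x vs e) = zone_size x ^ size vs.
Proof.
elim: vs e => [//|v vs IH] e /=; rewrite size_flatten /shape -map_comp.
rewrite (eq_map (g := fun=> zone_size x ^ size vs)); last by move=> k /=; rewrite IH.
by rewrite sumnE big_map big_const_seq count_predT size_iota iter_addn_0 expnS mulnC.
Qed.

(** This form of a position can be printed by one loop that compares two marks. *)
Definition onehot_digit (x : seq bool) (j : nat) : seq bool :=
  [seq j == k | k <- iota 0 (zone_size x)].

Definition onehot (x : seq bool) (vs : seq V) (e : env V) : seq bool :=
  flatten [seq onehot_digit x (e v) | v <- vs].

Lemma size_onehot x vs e : size (onehot x vs e) = size vs * zone_size x.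
Proof. by rewrite /onehot; elim: vs => //= v vs IH; rewrite size_cat IH size_map size_iota. Qed.

Lemma onehot_digit_inj x : {in gtn (zone_size x) &, injective (onehot_digit x)}.
Proof.
move=> j k; rewrite !inE => jN kN /eq_in_map /(_ j).
by rewrite mem_iota eqxx => /(_ jN) /esym /eqP.
Qed.

Lemma uniq_flatten_key (T K : eqType) (F : nat -> seq T) (key : T -> K) (g : nat -> K) ks :
  uniq ks -> {in ks &, injective g} -> (forall k, k \in ks -> uniq (F k)) ->
  (forall k y, k \in ks -> y \in F k -> key y = g k) -> uniq (flatten (map F ks)).
Proof.
elim: ks => //= k ks IH /andP[kks uks] gi uF kF; rewrite cat_uniq uF ?mem_head //=.
rewrite IH //; last first.
- by move=> l y ly; apply: kF; rewrite inE ly orbT.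
- by move=> l ly; apply: uF; rewrite inE ly orbT.
- by move=> l m lk mk; apply: gi; rewrite inE ?lk ?mk orbT.
rewrite andbT; apply/hasPn => y /flattenP[_ /mapP[l lks ->] yl].
apply: contra kks => yk; suff <- : l = k by [].
apply: gi; rewrite ?inE ?lks ?eqxx ?orbT //.
by rewrite -(kF l y) ?inE ?lks ?orbT // -(kF k y) ?inE ?eqxx.
Qed.

Lemma uniq_onehot x vs e : uniq vs -> uniq [seq onehot x vs e' | e' <- envs x vs e].
Proof.
elim: vs e => [//|v vs IH] e /= /andP[vvs uvs].
rewrite map_flatten -map_comp.
have ev k e' : e' \in envs x vs (upd e v k) -> e' v = k.
  by move=> /envs_notin ->; rewrite // ffunE eqxx.
apply: (@uniq_flatten_key _ _ _ (take (zone_size x)) (onehot_digit x)).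
- exact: iota_uniq.
- by move=> j k; rewrite !mem_iota /= => jN kN; apply: onehot_digit_inj.
- move=> k _ /=; have /eq_in_map -> : {in envs x vs (upd e v k),
     onehot x (v :: vs) =1 fun e' => onehot_digit x k ++ onehot x vs e'}.
    by move=> e' /ev <-.
  rewrite (map_comp (cat (onehot_digit x k)) (onehot x vs)) map_inj_uniq ?IH //.
  by move=> s t /eqP; rewrite eqseq_cat // => /andP[_ /eqP].
- move=> k _ _ /mapP[e' /ev <- ->]; rewrite /onehot /= take_size_cat //.
  by rewrite size_map size_iota.
Qed.

End ProgramCombinators.

Definition pairs (l : seq bool) : seq bool := flatten [seq [:: true; b] | b <- l].

Lemma pairs_cat l l' : pairs (l ++ l') = pairs l ++ pairs l'.
Proof. by rewrite /pairs map_cat flatten_cat. Qed.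

Section Digits.

Variable W : finType.
Notation V := (option W).
Implicit Type x : seq bool.

(** The variable [None] is reserved for printing: it runs through the zone, and each pass tests
    whether its mark meets that of [Some w]. *)
Definition pdigits (vs : seq W) : prog V :=
  pseqs [seq PFor None (PIf (fun c : cell V => c.2 None && c.2 (Some w))
    (PEmit _ [:: true; true]) (PEmit _ [:: true; false])) | w <- vs].

Lemma out_pdigits x vs e :
  out x (pdigits vs) e = pairs (onehot x (map some vs) e).
Proof.
rewrite out_pseqs /onehot; elim: vs => //= w vs ->.
rewrite pairs_cat /pairs /onehot_digit; congr (flatten _ ++ _); rewrite -map_comp.
apply/eq_in_map => k; rewrite mem_iota /= => kN.
have -> : has (fun c : cell V => c.2 None && c.2 (Some w)) (zone x (upd e None k)) =
    (e (Some w) == k).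
  apply/hasP/eqP => [[_ /mapP[j _ ->]]|ek].
    by rewrite /= !ffunE /= => /andP[/eqP -> /eqP].
  exists (cell_at x (upd e None k) k); first by apply: map_f; rewrite mem_iota.
  by rewrite /= !ffunE /= ek !eqxx.
by case: eqP.
Qed.

Lemma well_scoped_pdigits u vs : None \notin u -> well_scoped u (pdigits vs).
Proof. by move=> nu; rewrite well_scoped_pseqs all_map; apply/allP => w _ /=; rewrite nu. Qed.

Definition pzeros (n : nat) : prog V :=
  pseqs (nseq n (PFor None (PEmit _ [:: true; false]))).

Lemma pairs_nseq n : pairs (nseq n false) = flatten (nseq n [:: true; false]).
Proof. by rewrite /pairs map_nseq. Qed.

Lemma out_pzeros x n e : out x (pzeros n) e = pairs (nseq (n * zone_size x) false).
Proof.
rewrite out_pseqs map_nseq /=; elim: n => // n IH.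
rewrite mulSn nseqD pairs_cat -IH /=; congr (_ ++ _).
by rewrite pairs_nseq; elim: (zone_size x) 0 => //= m IHm j; rewrite IHm.
Qed.

Lemma well_scoped_pzeros u n : None \notin u -> well_scoped u (pzeros n).
Proof. by move=> nu; rewrite well_scoped_pseqs all_nseq /= nu orbT. Qed.

End Digits.

Section StateEq.

Variable D : finType.

Definition state_code (s : state D) : nat * option D * option D * nat :=
  match s with
  | sNo => (0, None, None, 0)
  | sGood => (1, None, None, 0)
  | sWait => (2, None, None, 0)
  | sY b => (3, None, None, nat_of_bool b)
  | sA a => (4, Some a, None, 0)
  | sB a b => (5, Some a, Some b, 0)
  | sC v j => (6, v, None, j)
  end.

Lemma state_code_inj : injective state_code.
Proof.
case=> [|||[]|a|a b|v j] [|||[]|a'|a' b'|v' j'] //=.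
- by case=> ->.
- by case=> -> ->.
- by case=> -> ->.
Qed.

HB.instance Definition _ := Equality.copy (state D) (inj_type state_code_inj).

End StateEq.

(** * Transitions and state names of the automaton for an input *)

Section Reduction.

Variable D : finType.
Variables (sep : D) (rej : pred D) (next : D -> D -> D -> D) (cell0 : bool -> option bool -> D).
Variable d : nat.

Notation W := (option 'I_d).
Notation V := (option W).
Notation state := (state D).
Implicit Type (x : seq bool) (s t : state).

(** The inner chain vertices form two segments, named by one and by [d] loop variables. The first
    one covers the whole input, so that initial letters in the second are blank; the second provides
    the polynomial length. *)
Definition chain_size x : nat := zone_size x + zone_size x ^ d.
Definition last_vertex x : nat := (chain_size x).+1.

(* The beginning of the history: [cell0 z b] is the letter of a cell holding [b], with the head
   on it if [z]. *)
Definition ini x (j : nat) : D :=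
  if (j == 0) || (j == (last_vertex x).+2) then sep else cell0 (j == 1) (onth x j.-1).

Definition edge_at x := edge rej next (ini x) (last_vertex x).

(* Chain vertices other than the two ends depend on [x]. The remaining states, as well as the
   tags that distinguish the names of all states, are represented by states of an automaton with
   a chain of length 5, where the vertices 1 and 2 are the tags of the two chain segments. *)
Definition base : seq state :=
  [:: sNo D; sGood D; sWait D; sY D false; sY D true] ++ [seq sA a | a <- enum D] ++
  [seq sB p.1 p.2 | p <- enum {: D * D}] ++
  [seq sC v 0 | v <- enum {: option D}] ++ [seq sC v 5 | v <- enum {: option D}].

Definition tags : seq state :=
  base ++ [seq sC v 1 | v <- enum {: option D}] ++ [seq sC v 2 | v <- enum {: option D}].

(** For a chain of length 5 the second separator is at 7. The other positions that base states test,
    0, 5 and 6, hold the same letters as their counterparts in the real automaton. *)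
Definition base_edge : state -> option D -> state -> bool :=
  edge rej next (fun j => if (j == 0) || (j == 7) then sep else cell0 false None) 5.

Definition real x s : state := if s is sC v j.+1 then sC v (last_vertex x) else s.

Definition tag x s : state :=
  if s is sC v j then
    sC v (if j == 0 then 0 else if j == last_vertex x then 5 else if j <= zone_size x then 1 else 2)
  else s.

Lemma mem_base s : (s \in base) = (if s is sC _ j then (j == 0) || (j == 5) else true).
Proof.
rewrite !mem_cat; case: s => [|||[]|a|a b|v j] //.
- by apply/orP; right; rewrite (map_f (@sA D)) ?mem_enum.
- do 2 (apply/orP; right).
  by rewrite (map_f (fun p => @sB D p.1 p.2) (x := (a, b))) ?mem_enum.
- rewrite [X in X || _]/=; have -> : (sC v j \in [seq sA a | a <- enum D]) = false.
    by apply/mapP => -[].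
  have -> : (sC v j \in [seq sB p.1 p.2 | p <- enum {: D * D}]) = false.
    by apply/mapP => -[].
  rewrite /=; apply/orP/orP => -[].
  + by case/mapP => w _ [_ ->]; left.
  + by case/mapP => w _ [_ ->]; right.
  + by move/eqP ->; left; rewrite (map_f (fun v => @sC D v 0)) ?mem_enum.
  + by move/eqP ->; right; rewrite (map_f (fun v => @sC D v 5)) ?mem_enum.
Qed.

Lemma mem_tags x s : tag x s \in tags.
Proof.
rewrite mem_cat mem_base; case: s => //= v j.
case: (j == 0) => //; case: (j == _) => //; apply/orP; right; rewrite mem_cat; apply/orP.
case: (j <= _); [left | right].
  by apply: (map_f (fun v => @sC D v 1)); rewrite mem_enum.
by apply: (map_f (fun v => @sC D v 2)); rewrite mem_enum.
Qed.

(** Base states test initial letters only at the separators and at two blank positions, where both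
    automata agree, and in either automaton the chain is too long for an edge between its ends. *)
Lemma base_edgeE x s t l : s \in base -> t \in base ->
  edge_at x (real x s) l (real x t) = base_edge s l t.
Proof.
rewrite !mem_base /edge_at; set J := last_vertex x.
have J1 : 1 < J by rewrite /J /last_vertex /chain_size /zone_size; lia.
have ini0 : ini x 0 = sep by [].
have iniJ2 : ini x J.+2 = sep by rewrite /ini eqxx orbT.
have iniJ k : k < 2 -> ini x (J + k) = cell0 false None.
  move=> k2; rewrite /ini -/J !ifF; last by lia.
  have -> : (J + k == 1) = false by lia.
  congr cell0; suff sz : size x <= (J + k).-1.
    by rewrite onthE nth_default // size_map.
  by rewrite /J /last_vertex /chain_size /zone_size; lia.
have [e0 e1] := (iniJ 0 isT, iniJ 1 isT); rewrite addn0 in e0; rewrite addn1 in e1.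
case: s => [|||[]|a|a b|[v|] [|[|[|[|[|[|j]]]]]]] //=;
case: t => [|||[]|a'|a' b'|[v'|] [|[|[|[|[|[|j']]]]]]] //=; case: l => [c|] //= _ _;
  rewrite ?e0 ?e1 ?iniJ2 ?addn0 ?addn1 ?e1 ?iniJ2 ?eqxx ?leqnn -/J ?andbF //=;
  by rewrite ?ltnn ?(gtn_eqF J1) ?andbF.
Qed.

Definition state_ok x s : bool := if s is sC v j then j <= last_vertex x else true.

Definition base_trans : seq (state * option D * state) :=
  [seq e <- [seq (st.1, l, st.2) | st <- [seq (s, t) | s <- base, t <- base],
                                  l <- enum {: option D}]
     | base_edge e.1.1 e.1.2 e.2].

Definition chain_trans x : seq (state * option D * state) :=
  flatten [seq [seq (sC p.1 j, Some p.2, sC p.1 j.+1) | j <- iota 0 (last_vertex x)]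
            | p <- enum {: option D * D}].

Definition ini_trans x : seq (state * option D * state) :=
  flatten [seq [seq (sC None j, Some a, sGood D) | a <- [seq a <- enum D | a != ini x j]]
            | j <- iota 1 (chain_size x)].

Definition trans x : seq (state * option D * state) :=
  [seq (real x e.1.1, e.1.2, real x e.2) | e <- base_trans] ++ chain_trans x ++ ini_trans x.

Lemma real_ok x s : s \in base -> state_ok x (real x s).
Proof. by case: s => // v [|j] _ /=. Qed.

Lemma trans_edge x s l t : (s, l, t) \in trans x ->
  [/\ edge_at x s l t, state_ok x s & state_ok x t].
Proof.
rewrite !mem_cat => /or3P[].
- case/mapP => -[[s' l'] t']; rewrite mem_filter => /andP[e].
  case/allpairsP => -[[s1 t1] l1] [/allpairsP[[s2 t2] [/= sb tb [e1 e2]]] _ [e3 e4 e5]].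
  subst => -[-> -> ->]; rewrite -/(edge_at x _ _ _).
  by split; [rewrite base_edgeE | exact: real_ok | exact: real_ok].
- case/flattenP => _ /mapP[[v a] _ ->] /mapP[j]; rewrite mem_iota /= => jJ [-> -> ->].
  split=> //=; last exact: ltnW.
  by rewrite /edge_at /=; case: (v) => [w|]; rewrite /= !eqxx jJ.
- case/flattenP => _ /mapP[j jS ->] /mapP[a]; rewrite mem_filter => /andP[ne _] [-> -> ->].
  move: jS; rewrite mem_iota => /andP[_ jS].
  have jJ : j <= last_vertex x by rewrite /last_vertex; lia.
  by split=> //; rewrite /edge_at /= jJ.
Qed.

Lemma base_trans_mem x s l t : s \in base -> t \in base -> edge_at x (real x s) l (real x t) ->
  (real x s, l, real x t) \in trans x.
Proof.
move=> sb tb; rewrite base_edgeE // => e; rewrite mem_cat; apply/orP; left.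
apply/mapP; exists (s, l, t) => //; rewrite mem_filter; apply/andP; split=> //.
apply/allpairsP; exists ((s, t), l); split=> //; last by rewrite mem_enum.
by apply/allpairsP; exists (s, t).
Qed.

Lemma real_surj x s :
  (exists2 s', s' \in base & s = real x s') \/
  (exists v j, [/\ s = sC v j, 0 < j & j != last_vertex x]).
Proof.
case: s => [|||b|a|a b|v j]; last first.
  case: (posnP j) => [->|j0]; first by left; exists (sC v 0); rewrite ?mem_base.
  case: (altP (j =P last_vertex x)) => [->|jJ]; last by right; exists v, j.
  by left; exists (sC v 5); rewrite ?mem_base.
- by left; exists (sB a b); rewrite ?mem_base.
- by left; exists (sA a); rewrite ?mem_base.
- by left; exists (sY D b); rewrite ?mem_base.
- by left; exists (sWait D); rewrite ?mem_base.
- by left; exists (sGood D); rewrite ?mem_base.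
- by left; exists (sNo D); rewrite ?mem_base.
Qed.

Lemma chain_trans_mem x v j a : j < last_vertex x ->
  (sC v j, Some a, sC v j.+1) \in trans x.
Proof.
move=> jJ; rewrite !mem_cat; apply/or3P; apply: Or32; apply/flattenP.
exists [seq (sC v j, Some a, sC v j.+1) | j <- iota 0 (last_vertex x)].
  by apply/mapP; exists (v, a); rewrite ?mem_enum.
by apply/mapP; exists j; rewrite ?mem_iota.
Qed.

Lemma edge_chain x v j a w k : 0 < k -> edge_at x (sC v j) (Some a) (sC w k) ->
  [/\ w = v, k = j.+1 & j < last_vertex x].
Proof.
case: k => // k _; have -> : edge_at x (sC v j) (Some a) (sC w k.+1) =
    [&& v == w, k.+1 == j.+1 & j < last_vertex x] by case: v.
by case/and3P => /eqP -> /eqP -> ->.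
Qed.

(** An edge at an inner chain vertex either runs along the chain or reads a wrong initial letter and
    enters [sGood]; the remaining ones come from edges between base states or run along the
    chain. *)
Lemma edge_trans x s l t : state_ok x s -> edge_at x s l t -> (s, l, t) \in trans x.
Proof.
move=> so e.
case: (real_surj x s) => [[s' s'b es]|[v [j [es j0 jJ]]]].
  case: (real_surj x t) => [[t' t'b et]|[w [k [et k0 kJ]]]].
    by rewrite es et; apply: base_trans_mem; rewrite -?es -?et.
  move: e so; rewrite et /edge_at {s' s'b es et}.
  case: l => [a|]; last first.
    by rewrite edge_sep => /andP[_]; case: w => //; case: k k0 {kJ}.
  case: s => [|||[]|b|b c|v j] // e; first by move: e; case: k k0 kJ => // k _ _; case: w.
  by have [-> -> jJ] := edge_chain k0 e; move=> _; apply: chain_trans_mem.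
move: e so; rewrite es /edge_at {s es}.
case: l => [a|]; last by rewrite edge_sep.
case: t => [|||[]|b|b c|w k] //=.
- by case: v.
- case: v => [v|]; first by rewrite (negbTE jJ).
  case/andP=> jJ' ne _; rewrite /trans 2!mem_cat; apply/or3P; apply: Or33; apply/flattenP.
  exists [seq (sC None j, Some a, sGood D) | a <- [seq a <- enum D | a != ini x j]].
    apply/mapP; exists j; rewrite // mem_iota j0 /=.
    by move: jJ' jJ; rewrite /last_vertex; lia.
  by apply/mapP; exists a; rewrite // mem_filter ne mem_enum.
- by case: v.
- by case: v.
- by case: v => [v|]; rewrite ?(negbTE jJ).
- by case: v.
- by case: v.
- move=> e _; have [-> -> jJ'] : [/\ w = v, k = j.+1 & j < last_vertex x].
    by case: v e => [v|] /and3P[/eqP <- /eqP -> ->].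
  exact: chain_trans_mem.
Qed.

Definition digits1 : seq W := [:: None].
Definition digits2 : seq W := [seq Some i | i <- enum 'I_d].

Definition fronts_of x (ds : seq W) : seq (seq bool) :=
  [seq onehot x (map some ds) e | e <- envs x (map some ds) (idle_env V x)].

(** The digit parts of the names of the inner vertices, in the order of the chain. *)
Definition fronts x : seq (seq bool) := fronts_of x digits1 ++ fronts_of x digits2.

Lemma size_fronts1 x : size (fronts_of x digits1) = zone_size x.
Proof. by rewrite size_map size_envs expn1. Qed.

Lemma size_fronts2 x : size (fronts_of x digits2) = zone_size x ^ d.
Proof. by rewrite size_map size_envs 2!size_map size_enum_ord. Qed.

Lemma size_fronts x : size (fronts x) = chain_size x.
Proof. by rewrite size_cat size_fronts1 size_fronts2. Qed.

Lemma uniq_fronts_of x ds : uniq ds -> uniq (fronts_of x ds).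
Proof. by move=> u; apply: uniq_onehot; rewrite map_inj_uniq // => ? ? []. Qed.

Lemma uniq_digits2 : uniq digits2.
Proof. by rewrite map_inj_uniq ?enum_uniq // => ? ? []. Qed.

Definition rank s : nat := index s tags.

(** A unary rank that can be split off from the right end of a name, whatever digits precede it. *)
Definition tag_bits s : seq bool := false :: nseq (rank s) true.

(** The index of [last_vertex x] is beyond [fronts x], so the default [[::]] gives this vertex no
    digits and the names of base states do not depend on [x]. *)
Definition name_bits x s : seq bool :=
  (if s is sC v j.+1 then nth [::] (fronts x) j else [::]) ++ tag_bits (tag x s).

Definition name x s : nat := num_of_bits (name_bits x s).

Lemma cat_unary_inj (f f' : seq bool) n m :
  f ++ false :: nseq n true = f' ++ false :: nseq m true -> f = f' /\ n = m.
Proof.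
move=> /(congr1 rev); rewrite !rev_cat !rev_cons !rev_nseq => e.
suff [-> /(can_inj revK) ->] : n = m /\ rev f = rev f' by [].
by elim: n m e => [|n IH] [|m] //=; [case | case=> /IH[-> ->]].
Qed.

Lemma cat_tag_bits_inj f f' s s' : s \in tags -> s' \in tags ->
  f ++ tag_bits s = f' ++ tag_bits s' -> f = f' /\ s = s'.
Proof.
move=> st s't /cat_unary_inj[-> e]; split=> //.
by have := nth_index s st; rewrite -/(rank s) e /rank nth_index.
Qed.

(** The tag determines the state up to the position in a chain segment, and digit strings are
    distinct within a segment. *)
Lemma name_inj x s t : state_ok x s -> state_ok x t -> name x s = name x t -> s = t.
Proof.
move=> so to /num_of_bits_inj /(cat_tag_bits_inj (mem_tags x s) (mem_tags x t))[].
case: s t so to => [|||b|a|a b|v j] [|||b'|a'|a' b'|w k] //= jJ kJ fE [<-].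
rewrite -/(last_vertex x).
have [j0|j0] := posnP j; have [k0|k0] := posnP k; rewrite ?j0 ?k0 //=.
- by case: ifP => // _; case: ifP.
- by case: ifP => // _; case: ifP.
case: eqP => [->|jl]; case: eqP => [->|kl] //; try by case: ifP.
have un ds (i l : nat) : uniq ds -> i < size (fronts_of x ds) -> l < size (fronts_of x ds) ->
    nth [::] (fronts_of x ds) i = nth [::] (fronts_of x ds) l -> i = l.
  by move=> u iN lN /eqP; rewrite nth_uniq ?uniq_fronts_of // => /eqP.
case: j k j0 k0 jl kl jJ kJ fE => // j [//|k] _ _ jl kl jJ kJ /=.
rewrite /fronts !nth_cat size_fronts1.
case: ltnP => jN; case: ltnP => kN // + _.
  by move/un => -> //; rewrite size_fronts1.
move/un => e; congr (sC _ _); have := e uniq_digits2; rewrite size_fronts2.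
by rewrite /last_vertex /chain_size in jl kl jJ kJ; lia.
Qed.

Definition name_size x : nat := d.+1 * zone_size x + (size tags).+2.

Lemma size_name_bits x s : size (name_bits x s) < name_size x.
Proof.
rewrite size_cat /= size_nseq /name_size.
have : rank (tag x s) <= size tags by rewrite /rank index_size.
suff : size (if s is sC _ j.+1 then nth [::] (fronts x) j else [::]) <= d.+1 * zone_size x by lia.
case: s => // v [//|j]; case: (ltnP j (size (fronts x))) => [jS|jS]; last first.
  by rewrite nth_default.
have := mem_nth [::] jS; rewrite mem_cat => /orP[] /mapP[e _ ->]; rewrite size_onehot size_map.
  by rewrite /= mul1n mulSn leq_addr.
by rewrite size_map size_enum_ord mulSn leq_addl.
Qed.

(** * The instance and its correctness *)

Definition letter_code (l : option D) : nat := enum_rank l.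

Definition alphabet_size : nat := #|{: option D}|.

Lemma letter_code_inj : injective letter_code.
Proof. by move=> l l' /val_inj /enum_rank_inj. Qed.

Lemma letter_codeK (w : word) :
  all (fun a => a < alphabet_size) w -> exists w', w = map letter_code w'.
Proof.
elim: w => [|a w IH] /=; first by exists [::].
case/andP=> ak /IH[w' ->]; exists (enum_val (Ordinal ak) :: w').
by rewrite /= /letter_code enum_valK.
Qed.

Definition starts : seq state := [:: sNo D; sWait D; sC None 0].
Definition finals : seq state := [:: sNo D; sGood D].

Lemma mem_starts s : (s \in starts) = is_start s.
Proof. by rewrite !inE; case: s => // -[v|] [|j]. Qed.

Lemma mem_finals s : (s \in finals) = is_final s.
Proof. by rewrite !inE; case: s. Qed.

(** The number of states is [2 ^ name_size x], which exceeds all names and has a short binary code;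
    numbers that name no state are isolated vertices. *)
Definition nfa_of x : nfa :=
  NFA (num_of_bits (nseq (name_size x) false))
      [seq (name x e.1.1, letter_code e.1.2, name x e.2) | e <- trans x]
      (map (name x) starts) (map (name x) finals).

Definition run_at x := run rej next (ini x) (last_vertex x).

Lemma nfa_run_name x s w t :
  state_ok x s -> run_at x s w t -> nfa_run (nfa_of x) (name x s) (map letter_code w) (name x t).
Proof.
elim: w s => [|l w IH] s so /=; first by move=> ->.
case=> r e h; have str := edge_trans so e; exists (name x r); split.
  by apply/mapP; exists (s, l, r).
by have [_ _ ro] := trans_edge str; apply: IH.
Qed.

Lemma nfa_run_inv x s w q :
  state_ok x s -> nfa_run (nfa_of x) (name x s) w q ->
  exists w' t, [/\ w = map letter_code w', q = name x t, state_ok x t & run_at x s w' t].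
Proof.
elim: w s => [|a w IH] s so /=; first by move=> <-; exists [::], s.
case=> _ [/mapP[[[s' l] r] str [sE -> ->]] h].
have [e s'o ro] := trans_edge str; rewrite /= in sE h.
have [w' [t [-> -> to rt]]] := IH _ ro h.
exists (l :: w'), t; split=> //; exists r => //.
by rewrite (name_inj so s'o sE).
Qed.

Lemma start_ok x s : is_start s -> state_ok x s.
Proof. by case: s => // -[v|] [|j]. Qed.

Definition flawless x (u : seq D) : Prop := ~ flawed_block sep rej next (ini x) (last_vertex x) u.

Definition instance_of x : instance := Instance alphabet_size (nfa_of x) 0%R.

Lemma name_lt x s : name x s < nfa_nstates (nfa_of x).
Proof. by apply: num_of_bits_lt; apply: size_name_bits. Qed.

Lemma letter_code_lt l : letter_code l < alphabet_size.
Proof. exact: ltn_ord. Qed.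

Lemma instance_of_valid x : inst_valid (instance_of x).
Proof.
apply/andP; split; first (apply/andP; split).
- apply/allP => _ /mapP[[[s l] t] _ ->]; apply/and3P.
  by split; [exact: name_lt | exact: letter_code_lt | exact: name_lt].
- by apply/allP => _ /mapP[s _ ->]; exact: name_lt.
- by apply/allP => _ /mapP[s _ ->]; exact: name_lt.
Qed.

Lemma nfa_lang_avoid x u (y v w : word) : flawless x u ->
  nfa_lang alphabet_size (nfa_of x) y ->
  y <> v ++ map letter_code (None :: map some u ++ [:: None]) ++ w.
Proof.
move=> fu [_ [_ [_ [/mapP[p ps ->] [/mapP[q qf ->] r]]]]] yE.
have po : state_ok x p by apply: start_ok; rewrite -mem_starts.
have [z [t' [zE _ _ rz]]] := nfa_run_inv po r.
apply: fu; rewrite yE in zE.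
pose z2 := drop (size v) z.
pose b := None :: map some u ++ [:: None].
have z2E : map letter_code z2 = map letter_code b ++ w.
  by rewrite map_drop -zE drop_size_cat.
have bE : take (size b) z2 = b.
  by apply: (inj_map letter_code_inj); rewrite map_take z2E take_size_cat // size_map.
move: rz; rewrite -(cat_take_drop (size v) z) -/z2 -(cat_take_drop (size b) z2) bE.
rewrite /b /= -catA /=; apply: run_block.
Qed.

Lemma nfa_lang_full x : (forall u, ~ flawless x u) ->
  subset (sigma_star alphabet_size) (nfa_lang alphabet_size (nfa_of x)).
Proof.
move=> fl w wk; split=> //; have [w' wE] := letter_codeK wk.
have fl' u : flawed_block sep rej next (ini x) (last_vertex x) u by apply: contrapT; apply: fl.
have [s [t [ss tf r]]] := flawed_run_all fl' w'.
exists (name x s), (name x t); split; first by rewrite map_f // mem_starts.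
split; first by rewrite map_f // mem_finals.
by rewrite wE; apply: nfa_run_name => //; apply: start_ok.
Qed.

(** Without flawless blocks the automaton accepts every word. A flawless [u] between two separators
    gives a factor that no accepted word has, and its powers keep the value positive. *)
Lemma AH_language_instance_of x :
  AH_language (enc_instance (instance_of x)) <-> (forall u, ~ flawless x u).
Proof.
have ah0 : AH_problem (instance_of x) <->
    (AH_ned (sigma_star alphabet_size) (nfa_lang alphabet_size (nfa_of x)) <= 0)%E.
  by rewrite /AH_problem /= GRing.rmorph0.
split=> [[I [/enc_instance_inj -> [_ /ah0 ah]]] u fu|fl]; last first.
  exists (instance_of x); split=> //; split; first exact: instance_of_valid.
  by apply/ah0/AH_ned_subset/nfa_lang_full.
pose b := map letter_code (None :: map some u ++ [:: None]).
apply: (@AH_ned_avoid _ _ b) ah => // [n|y s t Yy]; last exact: nfa_lang_avoid fu Yy.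
rewrite /sigma_star /=; apply/allP => a /flattenP[_ /nseqP[-> _]] /mapP[l _ ->].
exact: letter_code_lt.
Qed.

(** * The program that prints the instance *)

Definition enc_state s : seq bool := enc_bits (true :: tag_bits s).
Definition enc_letter (l : option D) : seq bool := enc_nat (letter_code l).
Definition enc_edge (p : seq bool) (l : option D) (q : seq bool) : seq bool :=
  true :: p ++ enc_letter l ++ q.

Definition enc_name x s : seq bool := enc_nat (name x s).

Lemma enc_nameE x s : enc_name x s = enc_bits (true :: name_bits x s).
Proof. exact: enc_num_of_bits. Qed.

Lemma tag_real x s : s \in base -> tag x (real x s) = s.
Proof. by rewrite mem_base; case: s => // v [|j] //= /eqP[->]; rewrite eqxx. Qed.

Lemma name_bits_real x s : s \in base -> name_bits x (real x s) = tag_bits s.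
Proof.
move=> sb; rewrite /name_bits tag_real //; suff -> :
  (if real x s is sC v j.+1 then nth [::] (fronts x) j else [::]) = [::] by [].
by case: s {sb} => // v [|j] //; apply: nth_default; rewrite size_fronts.
Qed.

Lemma enc_name_real x s : s \in base -> enc_name x (real x s) = enc_state s.
Proof. by move=> sb; rewrite enc_nameE name_bits_real. Qed.

Definition out_trans x (es : seq (state * option D * state)) : seq bool :=
  flatten [seq enc_edge (enc_name x e.1.1) e.1.2 (enc_name x e.2) | e <- es].

Lemma out_trans_cat x es es' : out_trans x (es ++ es') = out_trans x es ++ out_trans x es'.
Proof. by rewrite /out_trans map_cat flatten_cat. Qed.

Lemma out_trans_flatten x ess : out_trans x (flatten ess) = flatten (map (out_trans x) ess).
Proof. by rewrite /out_trans flatten_flatten_map. Qed.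

Definition base_string : seq bool :=
  flatten [seq enc_edge (enc_state e.1.1) e.1.2 (enc_state e.2) | e <- base_trans].

Lemma base_trans_base s l t : (s, l, t) \in base_trans -> s \in base /\ t \in base.
Proof.
rewrite mem_filter => /andP[_ /allpairsP[[[s1 t1] l1] [mem_st _ [e3 e4 e5]]]].
case/allpairsP: mem_st => -[s2 t2] [sb tb [e1 e2]].
by subst.
Qed.

Lemma out_trans_base x :
  out_trans x [seq (real x e.1.1, e.1.2, real x e.2) | e <- base_trans] = base_string.
Proof.
rewrite /out_trans -map_comp; congr flatten; apply/eq_in_map => -[[s l] t].
by move=> /base_trans_base[sb tb] /=; rewrite !enc_name_real.
Qed.

(** Lets two loop nests, one for each segment and tag, stand for one pass along the inner
    vertices. *)
Lemma map_fronts (T : Type) x (F : nat -> seq bool -> T) :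
  [seq F 1 f | f <- fronts_of x digits1] ++ [seq F 2 f | f <- fronts_of x digits2] =
  [seq F (if j <= zone_size x then 1 else 2) (nth [::] (fronts x) j.-1)
    | j <- iota 1 (chain_size x)].
Proof.
have h ds c k : [seq F c f | f <- fronts_of x ds] =
    [seq F c (nth [::] (fronts_of x ds) (j - k)) | j <- iota k (size (fronts_of x ds))].
  have -> : iota k (size (fronts_of x ds)) = map (addn k) (iota 0 (size (fronts_of x ds))).
    by rewrite -iotaDl addn0.
  rewrite -{1}(mkseq_nth [::] (fronts_of x ds)) -!map_comp.
  by apply: eq_map => j /=; rewrite addKn.
rewrite /chain_size iotaD map_cat (h digits1 1 1) (h digits2 2 (1 + zone_size x)).
rewrite size_fronts1 size_fronts2; congr (_ ++ _); apply/eq_in_map => j.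
  rewrite mem_iota => /andP[j1 jN]; rewrite ifT; last by lia.
  by rewrite nth_cat size_fronts1 ifT ?subn1 //; lia.
rewrite mem_iota => /andP[j1 jN]; rewrite ifF; last by lia.
by rewrite nth_cat size_fronts1 ifF; [congr (F _ (nth _ _ _)); lia | lia].
Qed.

Lemma enc_name_chain x v j : 0 < j -> j <= chain_size x ->
  enc_name x (sC v j) = enc_bits (true :: nth [::] (fronts x) j.-1 ++
    tag_bits (sC v (if j <= zone_size x then 1 else 2))).
Proof.
case: j => // j _ jS; rewrite enc_nameE /name_bits /=; congr (enc_bits (true :: _ ++ tag_bits _)).
by rewrite ifF // /last_vertex; lia.
Qed.

Lemma enc_bits_cons l : enc_bits (true :: l) = [:: true; true] ++ pairs l ++ [:: false].
Proof. by []. Qed.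

(** The first two bits encode the leading 1 that [num_of_bits] puts in front of a name. *)
Definition pname (ds : seq W) (v : option D) (c : nat) : prog V :=
  PSeq (PEmit _ [:: true; true]) (PSeq (pdigits ds)
    (PEmit _ (pairs (tag_bits (sC v c)) ++ [:: false]))).

Lemma out_pname x ds v c e :
  out x (pname ds v c) e = enc_bits (true :: onehot x (map some ds) e ++ tag_bits (sC v c)).
Proof.
rewrite enc_bits_cons pairs_cat -catA -out_pdigits.
by [].
Qed.

(* Otherwise unification computes positions in [tags]. *)
#[local] Opaque rank.

(* The chain is written as a single stream: each inner vertex closes one transition and opens the
   next one, so that the successor of a digit vector is never computed. *)
Definition plink ds v c a : prog V :=
  PSeq (pname ds v c) (PSeq (PEmit _ [:: true])
    (PSeq (pname ds v c) (PEmit _ (enc_letter (Some a))))).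

Definition pchain (p : option D * D) : prog V :=
  PSeq (PEmit _ (true :: enc_state (sC p.1 0) ++ enc_letter (Some p.2)))
  (PSeq (pfors (map some digits1) (plink digits1 p.1 1 p.2))
  (PSeq (pfors (map some digits2) (plink digits2 p.1 2 p.2))
        (PEmit _ (enc_state (sC p.1 5))))).

(** The same stream bracketed in two ways: cut at the vertices on the left, as it is printed, and
    cut between edges on the right. *)
Lemma link_edges (g : nat -> seq bool) l j n :
  (true :: g j ++ enc_letter l) ++
    flatten [seq g i ++ true :: g i ++ enc_letter l | i <- iota j.+1 n] ++ g (j + n).+1 =
  flatten [seq enc_edge (g i) l (g i.+1) | i <- iota j n.+1].
Proof.
elim: n j => [|n IH] j; first by rewrite addn0 /= cats0 -catA.
have := IH j.+1; rewrite addSnnS => e.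
transitivity (enc_edge (g j) l (g j.+1) ++
  flatten [seq enc_edge (g i) l (g i.+1) | i <- iota j.+1 n.+1]); last by [].
rewrite -e /enc_edge.
have -> : flatten [seq g i ++ true :: g i ++ enc_letter l | i <- iota j.+1 n.+1] =
  (g j.+1 ++ true :: g j.+1 ++ enc_letter l) ++
  flatten [seq g i ++ true :: g i ++ enc_letter l | i <- iota j.+2 n] by [].
by rewrite /= -!catA /= -!catA.
Qed.

Lemma out_pfors_fronts x ds (p : prog V) (F : seq bool -> seq bool) :
  (forall e, out x p e = F (onehot x (map some ds) e)) ->
  out x (pfors (map some ds) p) (idle_env V x) = flatten [seq F f | f <- fronts_of x ds].
Proof.
by move=> pF; rewrite out_pfors /fronts_of -map_comp; congr flatten; apply: eq_map.
Qed.

Lemma out_pchain x p :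
  out x (pchain p) (idle_env V x) =
  out_trans x [seq (sC p.1 j, Some p.2, sC p.1 j.+1) | j <- iota 0 (last_vertex x)].
Proof.
case: p => v a; pose F c f := let s := enc_bits (true :: f ++ tag_bits (sC v c)) in
  s ++ true :: s ++ enc_letter (Some a).
have outF ds c e : out x (plink ds v c a) e = F c (onehot x (map some ds) e).
  by rewrite /F -out_pname.
apply: (etrans (congr2 (fun u w => (true :: enc_state (sC v 0) ++ enc_letter (Some a)) ++
  u ++ w ++ enc_state (sC v 5))
  (out_pfors_fronts (outF digits1 1)) (out_pfors_fronts (outF digits2 2)))).
rewrite [flatten _ ++ _ ++ _]catA -flatten_cat map_fronts /out_trans -map_comp /last_vertex.
rewrite -(@link_edges (fun j => enc_name x (sC v j)) (Some a) 0 (chain_size x)) add0n.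
rewrite -(@enc_name_real x (sC v 0)) ?mem_base // -(@enc_name_real x (sC v 5)) ?mem_base //.
rewrite /=; congr (true :: _ ++ flatten _ ++ _); apply/eq_in_map => j.
rewrite mem_iota => /andP[j0 jS]; rewrite /F -enc_name_chain //; lia.
Qed.

Definition pini ds c (a : D) : prog V :=
  PSeq (PEmit _ [:: true]) (PSeq (pname ds None c)
    (PEmit _ (enc_letter (Some a) ++ enc_state (sGood D)))).

(** The loop variable marks one cell, whose flag and input bit determine the initial letter at the
    corresponding chain vertex. *)
Definition pini1 : prog V :=
  pfors (map some digits1) (pseqs [seq PIf
    (fun c : cell V => c.2 (Some None) && (a != cell0 c.1.1 c.1.2))
    (pini digits1 1 a) (PEmit _ [::]) | a <- enum D]).

Definition pini2 : prog V :=
  pfors (map some digits2) (pseqs [seq pini digits2 2 a | a <- enum D & a != cell0 false None]).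

Lemma out_pini x ds c a e :
  out x (pini ds c a) e =
  enc_edge (enc_bits (true :: onehot x (map some ds) e ++ tag_bits (sC None c)))
    (Some a) (enc_state (sGood D)).
Proof. by rewrite -out_pname. Qed.

Lemma envs1 x (v : V) e : envs x [:: v] e = [seq upd e v k | k <- iota 0 (zone_size x)].
Proof. by rewrite /= flatten_map1. Qed.

Lemma nth_fronts1 x k : k < zone_size x ->
  nth [::] (fronts x) k = onehot x (map some digits1) (upd (idle_env V x) (Some None) k).
Proof.
move=> kN; rewrite nth_cat size_fronts1 kN /fronts_of envs1 -map_comp.
by rewrite (nth_map 0) ?size_iota // nth_iota.
Qed.

Definition ini_edges x j : seq (state * option D * state) :=
  [seq (sC None j, Some a, sGood D) | a <- [seq a <- enum D | a != ini x j]].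

Lemma out_trans_ini_edges x j : out_trans x (ini_edges x j) =
  flatten [seq enc_edge (enc_name x (sC None j)) (Some a) (enc_state (sGood D))
    | a <- enum D & a != ini x j].
Proof.
by rewrite /out_trans -map_comp -(@enc_name_real x (sGood D)) ?mem_base.
Qed.

Lemma out_pini1 x : out x pini1 (idle_env V x) =
  flatten [seq out_trans x (ini_edges x j) | j <- iota 1 (zone_size x)].
Proof.
have -> : iota 1 (zone_size x) = [seq k.+1 | k <- iota 0 (zone_size x)] by rewrite -(iotaDl 1 0).
rewrite out_pfors envs1 -2!map_comp; congr flatten.
apply/eq_in_map => k; rewrite mem_iota /= add0n => kN.
rewrite out_pseqs out_trans_ini_edges.
have kJ : k < chain_size x by rewrite /chain_size; lia.
have iniE : ini x k.+1 = cell0 (k == 0) (onth x k).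
  rewrite /ini /= ifF //; apply/negbTE; rewrite /last_vertex; lia.
set e := upd _ _ _.
have nameE : enc_name x (sC None k.+1) =
    enc_bits (true :: onehot x (map some digits1) e ++ tag_bits (sC None 1)).
  by rewrite (@enc_name_chain x None k.+1 isT kJ) (nth_fronts1 kN) kN.
have hasE a : has (fun c : cell V => c.2 (Some None) && (a != cell0 c.1.1 c.1.2)) (zone x e) =
    (a != ini x k.+1).
  rewrite iniE; apply/hasP/idP => [[_ /mapP[j _ ->]]|ak]; rewrite /= ?ffunE ?eqxx.
    by case/andP => /eqP ->.
  exists (cell_at x e k); first by apply: map_f; rewrite mem_iota.
  by rewrite /= !ffunE eqxx eqxx.
elim: (enum D) => [//|a s IH].
transitivity ((if a != ini x k.+1 then out x (pini digits1 1 a) e else [::]) ++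
    flatten [seq enc_edge (enc_name x (sC None k.+1)) (Some a) (enc_state (sGood D))
      | a <- s & a != ini x k.+1]); first by rewrite -IH -hasE.
rewrite [seq.filter _ (_ :: _)]/=; case: ifP => // _.
by rewrite out_pini -nameE.
Qed.

Lemma out_pini2 x : out x pini2 (idle_env V x) =
  flatten [seq out_trans x (ini_edges x j) | j <- iota (zone_size x).+1 (zone_size x ^ d)].
Proof.
pose blank := cell0 false None.
pose F f := flatten [seq enc_edge (enc_bits (true :: f ++ tag_bits (sC None 2))) (Some a)
    (enc_state (sGood D)) | a <- enum D & a != blank].
rewrite (@out_pfors_fronts x digits2 _ F); last first.
  move=> e; rewrite out_pseqs -map_comp /F; congr flatten; apply: eq_map => a.
  by rewrite -out_pini.
have -> : iota (zone_size x).+1 (zone_size x ^ d) =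
    [seq (zone_size x).+1 + k | k <- iota 0 (zone_size x ^ d)] by rewrite -iotaDl addn0.
rewrite -{1}(mkseq_nth [::] (fronts_of x digits2)) size_fronts2 /mkseq -2!map_comp; congr flatten.
apply/eq_in_map => k; rewrite mem_iota /= add0n => kN.
have kJ : (zone_size x).+1 + k <= chain_size x by rewrite /chain_size addSn ltn_add2l.
have j0 : 0 < (zone_size x).+1 + k by [].
rewrite out_trans_ini_edges /F (enc_name_chain None j0 kJ).
have -> : ini x ((zone_size x).+1 + k) = blank.
  rewrite /ini ifF; last by rewrite /last_vertex /chain_size; lia.
  have -> : ((zone_size x).+1 + k == 1) = false by rewrite /zone_size; lia.
  by rewrite onthE nth_default // size_map /zone_size; lia.
rewrite ifF; last by lia.
by rewrite addSn /= nth_cat size_fronts1 ifF ?addKn //; lia.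
Qed.

Lemma out_ini x :
  out x pini1 (idle_env V x) ++ out x pini2 (idle_env V x) = out_trans x (ini_trans x).
Proof.
rewrite out_pini1 out_pini2 -flatten_cat -map_cat -[(zone_size x).+1]add1n -iotaD.
by rewrite out_trans_flatten -map_comp.
Qed.

(** After the alphabet size comes the number of states, the digit 1 followed by [name_size x] zeros,
    and then the transitions in the order of [trans], beginning with the constant [base_string]. *)
Definition reduction : prog V :=
  PSeq (PEmit _ (enc_nat alphabet_size ++ [:: true; true]))
  (PSeq (pzeros _ d.+1)
  (PSeq (PEmit _ (pairs (nseq (size tags).+2 false) ++ [:: false] ++ base_string))
  (PSeq (pseqs [seq pchain p | p <- enum {: option D * D}])
  (PSeq pini1
  (PSeq pini2
    (PEmit _ ([:: false] ++ enc_list enc_state starts ++ enc_list enc_state finals ++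
      enc_rat 0%R))))))).

Lemma out_reduction x : out x reduction (idle_env V x) = enc_instance (instance_of x).
Proof.
have -> : enc_instance (instance_of x) = enc_nat alphabet_size ++
    (enc_nat (num_of_bits (nseq (name_size x) false)) ++
     enc_list enc_triple [seq (name x e.1.1, letter_code e.1.2, name x e.2) | e <- trans x] ++
     enc_list enc_nat (map (name x) starts) ++ enc_list enc_nat (map (name x) finals)) ++
    enc_rat 0%R by [].
have baseP s : s \in [:: sNo D; sGood D; sWait D; sC None 0] -> enc_nat (name x s) = enc_state s.
  rewrite !inE => sb; have sb' : s \in base.
    by rewrite mem_base; case/or4P: sb => /eqP ->.
  rewrite -(enc_name_real x sb') /enc_name; congr (enc_nat (name x _)).
  by case/or4P: sb => /eqP ->.
have listE ss : {subset ss <= [:: sNo D; sGood D; sWait D; sC None 0]} ->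
    enc_list enc_nat (map (name x) ss) = enc_list enc_state ss.
  move=> ssb; rewrite /enc_list -map_comp; congr (flatten _ ++ _); apply/eq_in_map => s /ssb sb.
  by rewrite /= baseP.
rewrite !listE; last 2 first.
- by move=> s; rewrite !inE => /orP[] ->; rewrite ?orbT.
- by move=> s; rewrite !inE => /or3P[] ->; rewrite ?orbT.
have transE :
    enc_list enc_triple [seq (name x e.1.1, letter_code e.1.2, name x e.2) | e <- trans x] =
    out_trans x (trans x) ++ [:: false].
  by rewrite /enc_list -map_comp.
rewrite transE /trans !out_trans_cat out_trans_base -out_ini.
have -> : out_trans x (chain_trans x) =
    out x (pseqs [seq pchain p | p <- enum {: option D * D}]) (idle_env V x).
  rewrite out_pseqs out_trans_flatten -2!map_comp; congr flatten.
  by apply: eq_map => p; exact: esym (out_pchain x p).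
have -> : enc_nat (num_of_bits (nseq (name_size x) false)) =
    [:: true; true] ++ out x (pzeros _ d.+1) (idle_env V x) ++
    pairs (nseq (size tags).+2 false) ++ [:: false].
  rewrite enc_num_of_bits enc_bits_cons out_pzeros /name_size nseqD pairs_cat -catA.
  by [].
have assoc (a t z b f u c p q g h r : seq bool) :
    (a ++ t) ++ z ++ (b ++ f ++ u) ++ c ++ p ++ q ++ f ++ g ++ h ++ r =
    a ++ ((t ++ z ++ b ++ f) ++ ((u ++ c ++ p ++ q) ++ f) ++ g ++ h) ++ r.
  by rewrite -!catA.
exact: assoc.
Qed.

Lemma well_scoped_seq u (p q : prog V) :
  well_scoped u p -> well_scoped u q -> well_scoped u (PSeq p q).
Proof. by move=> /= -> ->. Qed.

Lemma well_scoped_reduction : well_scoped [::] reduction.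
Proof.
have disj ds : ~~ has (mem ([::] : seq V)) (map some ds) by apply/hasPn.
have u1 : uniq (map some digits1 : seq V) by [].
have u2 : uniq (map some digits2 : seq V).
  by rewrite map_inj_uniq ?uniq_digits2 // => ? ? [].
have wname ds c v : well_scoped (map some ds ++ [::] : seq V) (pname ds v c).
  do 2 (apply: well_scoped_seq => //); apply: well_scoped_pdigits.
  by rewrite cats0; apply/mapP => -[].
have wlink ds v c a : well_scoped (map some ds ++ [::] : seq V) (plink ds v c a).
  by do 3 (apply: well_scoped_seq => //).
have wini ds c a : well_scoped (map some ds ++ [::] : seq V) (pini ds c a).
  by do 2 (apply: well_scoped_seq => //).
apply: well_scoped_seq => //; apply: well_scoped_seq; first exact: well_scoped_pzeros.
apply: well_scoped_seq => //; apply: well_scoped_seq.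
  rewrite well_scoped_pseqs all_map; apply/allP => p _.
  apply: well_scoped_seq => //; apply: well_scoped_seq.
    exact: (well_scoped_pfors u1 (disj _) (wlink _ _ _ _)).
  by apply: well_scoped_seq => //; exact: (well_scoped_pfors u2 (disj _) (wlink _ _ _ _)).
apply: well_scoped_seq.
  apply: (well_scoped_pfors u1 (disj _)); rewrite well_scoped_pseqs all_map; apply/allP => a _.
  by apply/andP; split=> //; apply: wini.
apply: well_scoped_seq => //.
apply: (well_scoped_pfors u2 (disj _)); rewrite well_scoped_pseqs all_map; apply/allP => a _.
exact: wini.
Qed.

Theorem flawless_reduction : exists f, poly_time_computable f /\
  forall x, AH_language (f x) <-> (forall u, ~ flawless x u).
Proof.
exists (fun x => out x reduction (idle_env V x)); split.
  exact: out_poly_time well_scoped_reduction.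
by move=> x; rewrite out_reduction; apply: AH_language_instance_of.
Qed.

End Reduction.

(** * From space-bounded machines to the reduction *)

Lemma poly_bound_expn a d n : poly_bound a d n <= (n + 2) ^ (d + a).+1.
Proof.
have mono b e : b <= n + 2 -> b ^ e <= (n + 2) ^ e by case: e => // e; rewrite leq_exp2r.
have h1 : n ^ d <= (n + 2) ^ d by apply: mono; rewrite leq_addr.
have h2 : 1 <= (n + 2) ^ d by rewrite expn_gt0 addn2.
(* The coefficient is absorbed into the exponent, since [a <= 2 ^ a] and the base is at least 2. *)
have h3 : 2 * a <= (n + 2) ^ a.+1.
  rewrite expnS leq_mul ?leq_addl //.
  by apply: leq_trans (ltnW (ltn_expl a (ltnSn 1))) (mono _ _ _); rewrite leq_addl.
rewrite /poly_bound -addnS expnD; apply: leq_trans (leq_mul (leqnn _) h3).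
by nia.
Qed.

Definition input_letter (M : TM) (z : bool) (b : option bool) : letter M :=
  Some (inord (oapp sym_of_bit 0 b), if z then Some (inord (tm_start M)) else None).

Lemma history_ini M x K j : j <= K.+1 ->
  history M x K j =
  if (j == 0) || (j == K.+1) then None else input_letter M (j == 1) (onth x j.-1).
Proof.
have tx i : nth 0 (tape_of (tm_init M x)) i = oapp sym_of_bit 0 (onth x i).
  have -> : nth 0 (tape_of (tm_init M x)) i = nth 0 (map sym_of_bit x) i.
    by rewrite /tm_init /tape_of; case: x => [|b y] //=; case: i => [|[|i]].
  by elim: x i => [|b x IH] [|i] /=.
rewrite leq_eqVlt => /orP[/eqP ->|jK].
  by rewrite eqxx orbT -{1}[K.+1]mul1n -[1 * _]addn0 history_at.
rewrite (ltn_eqF jK) orbF -[j in LHS]add0n -(mul0n K.+1) history_at //.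
have -> : conf M x 0 = tm_init M x by [].
case: j jK => // j _; rewrite /= tx /input_letter /=.
have -> : cf_left (tm_init M x) = [::] by rewrite /tm_init; case: (map _ _).
have -> : cf_state (tm_init M x) = tm_start M by rewrite /tm_init; case: (map _ _).
by case: j.
Qed.

Theorem mainTheorem13 : PSPACE_hard AH_language.
Proof.
move=> L [M [a [d [M_wf ML]]]].
have [f [fP fL]] := @flawless_reduction (letter M) None (@rejecting M) (@next_letter M)
  (input_letter M) (d + a).+1.
exists f; split=> // x; rewrite fL.
(* With this [K], the block automaton compares letters at distance [K.+1], the length of a padded
   configuration. *)
pose K := (last_vertex (d + a).+1 x).+1.
have spK n c : tm_cfg M x n = Some c -> cf_space c <= K.
  move=> nc; have [_ /(_ n c nc) h] := ML x; apply: leq_trans h _.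
  (* The power of [zone_size x] that bounds the space is the length of the second chain segment. *)
  apply: leq_trans (poly_bound_expn _ _ _) _.
  by rewrite /K /last_vertex /chain_size /zone_size; lia.
have flawlessE u : flawless None (@rejecting M) (@next_letter M) (input_letter M) (d + a).+1 x u <->
    ~ flawed x K u.
  have iniE k : k <= K.+1 -> ini None (input_letter M) (d + a).+1 x k = history M x K k.
    by move=> kK; rewrite history_ini.
  split=> nf; [case=> [h|[k kw [kK ne]]|h] | case=> [h|[[k kw [kK ne]]|h]]]; apply: nf.
  - by left.
  - by right; left; exists k => //; rewrite iniE.
  - by right; right.
  - exact: Or31.
  - by apply: Or32; exists k => //; rewrite -iniE.
  - exact: Or33.
have [[n [c [nc [cN cL]]]] _] := ML x.
have rejL := rejecting_historyP M_wf spK nc cN cL.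
have flawP := not_flawedP M_wf spK.
split=> [Lx u /flawlessE nf|nf].
  by have /flawP/rejL : exists w : seq (letter M), ~ flawed x K w by exists u.
apply: contrapT => /rejL/flawP[u] /flawlessE; exact: nf.
Qed.
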